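(* Assume the induction hypothesis at time level $m$ (stated in the context). Then for all finite element functions $f_h,g_h\in S_h(\hat\Gamma_{h,*}^m)$ and all exponents with $1/p+1/q+1/r=1$, $$\Big|\int_{\Gamma_h^m}f_hg_h-\int_{\hat\Gamma_{h,*}^m}f_hg_h\Big|\lesssim\|\hat e_x^m\|_{L^p(\hat\Gamma_{h,*}^m)}\|f_h\|_{L^q(\hat\Gamma_{h,*}^m)}\|g_h\|_{L^r(\hat\Gamma_{h,*}^m)}.$$
   Context: **Exact interface.** $d\in\{2,3\}$; $\Omega\subset\mathbb R^d$ is a closed bounded domain; $\Gamma(t)\subset\Omega$, $t\in[0,T]$, is the sufficiently smooth closed interface of a sufficiently smooth two-phase Stokes flow with velocity $u$, enclosing $\Omega_-(t)$; $X^m:\Omega\to\Omega$ is its flow map at time $t_m=m\tau$ ($\partial_tX=u(X,t)$, $X^0=\mathrm{id}$). $\Gamma^m:=\Gamma(t_m)$ has outward unit normal $n^m$; $a^m$ is the smooth distance projection onto $\Gamma^m$ on a neighbourhood of $\Gamma^m$. **Finite elements.** $\Omega_{h,\rm f}^0$ is a shape-regular quasi-uniform simplicial triangulation of $\Omega$ with flat facets, mesh size $h$, fitted to $\Gamma^0$ through a union $\Gamma_{h,\rm f}^0$ of $(d-1)$-facets with vertices on $\Gamma^0$. Isoparametric triangulations of degree $k\ge3$ have elements $K=F_K(\hat K)$ with $F_K$ polynomial of degree $\le k$; $S_h=S_h^k$ is the space of $H^1$ functions $f$ with $f|_K\circ F_K\in\mathbb P^k(\hat K)$. Finite element functions on triangulations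 parametrized over each other are identified when they have the same nodal vector; the domain of a norm or integral indicates where the function is realized. $I_h$: Lagrange interpolation of degree $k$; $W_h^{s,q},H_h^s$: elementwise Sobolev spaces. $\hat\Omega_{h,*}^0$ is Lenoir's curved isoparametric deformation of $\Omega_{h,\rm f}^0$, with interface $\hat\Gamma_{h,*}^0$ parametrized by $I_h(a^0|_{\Gamma_{h,\rm f}^0})$; $\Phi^0:\hat\Omega_{h,*}^0\to\Omega$ is Lenoir's globally continuous, piecewise $C^{k+1}$ lift with $\Phi^0=a^0$ on $\hat\Gamma_{h,*}^0$. **Meshes at time level $m$.** $X_h^m:\Omega_{h,\rm f}^0\to\Omega_h^m$ is the finite element parametrization of the numerical mesh $\Omega_h^m$ with interface $\Gamma_h^m$ (computed at time level $m$ by a parametric finite element scheme for the two-phase Stokes flow). On the interface, $\hat X_{h,*}^m$ is the finite element function with nodal values $a^m(x_j^m)$, $x_j^m$ the nodes of $\Gamma_h^m$; its image is $\hat\Gamma_{h,*}^m$; $\hat e_x^m:=X_h^m-\hat X_{h,*}^m$. In the bulk, $\hat X_{h,*}^m:=X_h^m-E_h\hat e_x^m$ with image mesh $\hat\Omega_{h,*}^m$. Here $E_hf_h:=I_h^{\rm SZ}[(\eta E(f_h\circ(a^0|_{\hat\Gamma_{h,*}^0})^{-1}))\circ\Phi^0]\in S_h^k(\hat\Omega_{h,*}^0)$, with $E:W^{s-1/q,q}(\Gamma^0)\to W^{s,q}(\Omega\setminus\Gamma^0)$ a continuous trace extension operator, $\eta\in C_c^\infty(\Omega)$ equal to $1$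 near $\Omega_-(0)$, and $I_h^{\rm SZ}$ the Scott--Zhang interpolation on each of the two subdomains, glued. Also $e_{x,\#}^m:=X_h^m-I_h(X^m\circ\Phi^0)$. **Induction hypothesis.** $h^{-1}\|E_h\hat e_x^m\|_{W^{1,\infty}(\Omega_{h,\rm f}^0)}+h^{-3/2}\|E_h\hat e_x^m\|_{H^1(\Omega_{h,\rm f}^0)}+h^{-1}\|\hat e_x^m\|_{W^{1,\infty}(\Gamma_{h,\rm f}^0)}+h^{-3/2}\|\hat e_x^m\|_{H^1(\Gamma_{h,\rm f}^0)}+h^{-3/2}\|e_{x,\#}^m\|_{H^1(\Omega_{h,\rm f}^0)}\le1.$ **Constants.** For a triangulation $\mathcal T$ with domain $D(\mathcal T)$, parametrized by $F(\mathcal T)$ over the flat reference triangulation $\mathcal T_0$ ($\Omega_{h,\rm f}^0$ or $\Gamma_{h,\rm f}^0$): $\omega(\mathcal T):=\|F(\mathcal T)\|_{W_h^{k-1,4}(D(\mathcal T_0))}+\|F(\mathcal T)\|_{W_h^{k-2,\infty}(D(\mathcal T_0))}+\|F(\mathcal T)^{-1}\|_{W^{1,\infty}(D(\mathcal T))}$, $\omega_*(\mathcal T):=\|F(\mathcal T)\|_{H_h^k(D(\mathcal T_0))}$; $\mu_m=\omega(\hat\Omega_{h,*}^m)$, $\nu_m=\omega(\hat\Gamma_{h,*}^m)$, $\mu_{*,m}=\omega_*(\hat\Omega_{h,*}^m)$, $\nu_{*,m}=\omega_*(\hat\Gamma_{h,*}^m)$. $A\lesssim B$ means $A\le C_{\mu_m,\nu_m}B$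 with a constant possibly depending on $T$, $\mu_m$, $\nu_m$ (and the exact solution) but independent of $\tau,h,\mu_{*,m},\nu_{*,m}$. Standing convention: $h$ is sufficiently small, $h\le h_0(\mu_m,\nu_m,\mu_{*,m},\nu_{*,m})$. *)

(* Defs.v *)
From HB Require Import structures.
From mathcomp Require Import all_boot all_order all_algebra.
From mathcomp Require Import all_classical all_reals all_analysis.

Set Implicit Arguments.
Unset Strict Implicit.
Unset Printing Implicit Defensive.

Import Order.TTheory GRing.Theory Num.Theory.
Import numFieldNormedType.Exports.

Local Open Scope classical_set_scope.
Local Open Scope ring_scope.

(* Lebesgue measure on R^n, carried by n-tuples (which have a product
   sigma-algebra in the library) and built by iterating the product measure.
   Functions of a row vector are integrated after composition with [rv]. *)
Section lebesgue_tuple.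
Variable R : realType.
Local Notation mR := (measurableTypeR R).

Definition tcons n (p : mR * n.-tuple mR) : n.+1.-tuple mR :=
  [the n.+1.-tuple mR of p.1 :: p.2].

Lemma measurable_tcons n : measurable_fun [set: mR * n.-tuple mR] (@tcons n).
Proof. exact: measurable_cons. Qed.

Section step.
Let lam : {sigma_finite_measure set mR -> \bar R} := @lebesgue_measure R.
Variables (n : nat) (mu : {sigma_finite_measure set (n.-tuple mR) -> \bar R}).

Definition leb_cons : set (n.+1.-tuple mR) -> \bar R :=
  pushforward (lam \x mu)%E (@tcons n).

HB.instance Definition _ := Measure.copy leb_cons
  (measure_function_pushforward__canonical__measure_function_Measure
     [the {measure set _ -> \bar R} of (lam \x mu)%E] (@measurable_tcons n)).

Lemma leb_cons_sigma_finite : sigma_finite setT leb_cons.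
Proof.
have /sigma_finiteP[F [TF ndF Foo]] := sigma_finiteT lam.
have /sigma_finiteP[G [TG ndG Goo]] := sigma_finiteT mu.
pose uncons (t : n.+1.-tuple mR) : mR * n.-tuple mR :=
  (tnth t ord0, [tuple of behead t]).
have muncons : measurable_fun setT uncons.
  apply: measurable_fun_pair; first exact: measurable_tnth.
  exact: measurable_behead.
exists (fun i => uncons @^-1` (F i `*` G i)).
  rewrite -preimage_bigcup (_ : \bigcup_i _ = setT) ?preimage_setT//.
  rewrite -subTset => -[x y] _.
  have [i _ Fx] : (\bigcup_i F i) x by rewrite -TF.
  have [j _ Gy] : (\bigcup_i G i) y by rewrite -TG.
  exists (maxn i j) => //; split.
  - by move: x Fx; exact/subsetPset/ndF/leq_maxl.
  - by move: y Gy; exact/subsetPset/ndG/leq_maxr.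
move=> i; have [mF Fi] := Foo i; have [mG Gi] := Goo i; split.
  by rewrite -[X in measurable X]setTI; apply: muncons => //; exact: measurableX.
rewrite /leb_cons /pushforward -comp_preimage (_ : uncons \o @tcons n = id).
  by rewrite preimage_id product_measure1E// lte_mul_pinfty// ge0_fin_numE.
by apply/funext => -[x t]; rewrite /uncons /=; congr pair; apply: val_inj.
Qed.

HB.instance Definition _ := Measure_isSigmaFinite.Build _ _ _ leb_cons
  leb_cons_sigma_finite.
End step.

Definition leb0 : set (0.-tuple mR) -> \bar R := dirac ([tuple] : 0.-tuple mR).
HB.instance Definition _ := Measure.on leb0.
Lemma leb0_sigma_finite : sigma_finite setT leb0.
Proof.
exists (fun _ => setT); first by rewrite bigcup_const //; exists 0%N.
by move=> _; split => //; rewrite /leb0 diracT ltry.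
Qed.
HB.instance Definition _ := Measure_isSigmaFinite.Build _ _ _ leb0 leb0_sigma_finite.

Fixpoint leb n : {sigma_finite_measure set (n.-tuple mR) -> \bar R} :=
  match n with
  | 0 => leb0
  | n'.+1 => leb_cons (leb n')
  end.
End lebesgue_tuple.

Definition rv (R : realType) n (t : n.-tuple (measurableTypeR R)) : 'rV[R]_n :=
  \row_i tnth t i.

(* The norm of 'rV[R]_n in the library is the max norm. *)
Definition enorm (R : realType) n (v : 'rV[R]_n) : R :=
  Num.sqrt (\sum_i v ord0 i ^+ 2).

Fixpoint Ck (R : realType) (V W : normedModType R) (N : nat) (f : V -> W) :
    Prop :=
  continuous f /\
  if N is N'.+1 then
    forall v, (forall x, derivable f x v) /\ Ck N' (fun x => 'D_v f x)
  else True.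

(* C^N up to the boundary of D, in the sense of extension. *)
Definition Ck_on (R : realType) (V W : normedModType R) N (D : set V)
    (f : V -> W) : Prop :=
  exists2 g : V -> W, Ck N g & {in D, f =1 g}.

Definition spacetime (R : realType) n (W : Type) (f : R -> 'rV[R]_n -> W) :
    R^o * 'rV[R]_n -> W :=
  fun z => f z.1 z.2.

Section calculus.
Variables (R : realType) (n : nat).

Definition partial (W : normedModType R) (i : 'I_n) (f : 'rV[R]_n -> W) :
    'rV[R]_n -> W :=
  fun x => 'D_(delta_mx ord0 i) f x.

Definition partials (W : normedModType R) (s : seq 'I_n) (f : 'rV[R]_n -> W) :
    'rV[R]_n -> W :=
  foldr (@partial W) f s.

Definition grad (f : 'rV[R]_n -> R) (x : 'rV[R]_n) : 'rV[R]_n :=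
  \row_i partial (W := R^o) i f x.

Definition divergence (f : 'rV[R]_n -> 'rV[R]_n) (x : 'rV[R]_n) : R :=
  \sum_i partial (W := R^o) i (fun y => f y ord0 i) x.

(* Euclidean norm of the tensor of all l-th order derivatives. *)
Definition tensor_norm m l (f : 'rV[R]_n -> 'rV[R]_m) (x : 'rV[R]_n) : R :=
  Num.sqrt (\sum_(s : l.-tuple 'I_n) enorm (partials s f x) ^+ 2).

Definition test_fun (D : set 'rV[R]_n) (phi : 'rV[R]_n -> R) : Prop :=
  (forall N, Ck (W := R^o) N phi) /\
  exists K, [/\ compact K, K `<=` D & forall x, ~ K x -> phi x = 0].

(* [G s] is the weak derivative of f on D along the directions s. *)
Definition weak_derivatives (s : nat) (D : set 'rV[R]_n) (f : 'rV[R]_n -> R)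
    (G : seq 'I_n -> 'rV[R]_n -> R) : Prop :=
  {in D, G [::] =1 f} /\
  forall l, (size l <= s)%N ->
    (forall K, compact K -> K `<=` D ->
       (leb R n).-integrable (@rv R n @^-1` K) (EFin \o (G l \o @rv R n))) /\
    (forall phi, test_fun D phi ->
       \int[leb R n]_(t in @rv R n @^-1` D)
         (f (rv t) * partials (W := R^o) l phi (rv t)) =
       (-1) ^+ size l *
       \int[leb R n]_(t in @rv R n @^-1` D) (G l (rv t) * phi (rv t))).

(* The W^{s,q}(D) norm; it is +oo when f has no weak derivatives. *)
Definition Wnorm (s : nat) (q : \bar R) (D : set 'rV[R]_n)
    (f : 'rV[R]_n -> R) : \bar R :=
  ereal_inf [set B | exists2 G, weak_derivatives s D f G &
    B = (\sum_(l < s.+1) \sum_(i : l.-tuple 'I_n)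
           Lnorm (leb R n) q (fun t => (G i (rv t) * \1_D (rv t))%:E))%E].

End calculus.

(* A two-phase flow in dimension d = n.+1.  [dproj t] is the distance projection
   onto Gam t, meaningful at distance less than [width] from it.  Phases are
   indexed by booleans, [true] being the enclosed one; for each phase [vel] and
   [pres] are smooth extensions of the velocity and of the pressure. *)
Record flow (R : realType) (n : nat) := Flow {
  Om : set 'rV[R]_n.+1;
  Tend : R;
  Omin : R -> set 'rV[R]_n.+1;
  Gam : R -> set 'rV[R]_n.+1;
  nrm : R -> 'rV[R]_n.+1 -> 'rV[R]_n.+1;
  dproj : R -> 'rV[R]_n.+1 -> 'rV[R]_n.+1;
  width : R;
  flowmap : R -> 'rV[R]_n.+1 -> 'rV[R]_n.+1;
  vel : bool -> R -> 'rV[R]_n.+1 -> 'rV[R]_n.+1;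
  pres : bool -> R -> 'rV[R]_n.+1 -> R;
  force : bool -> R -> 'rV[R]_n.+1 -> 'rV[R]_n.+1;
  visc : bool -> R;
  surf_tension : R
}.

Section exact_flow.
Variables (R : realType) (n : nat) (S : flow R n).
Local Notation Rd := 'rV[R]_n.+1.

Definition phase (b : bool) (t : R) : set Rd :=
  if b then Omin S t else Om S `\` (Omin S t `|` Gam S t).

Definition tube (eps t : R) : set Rd :=
  [set x | exists2 y, Gam S t y & enorm (x - y) < eps].

Definition velocity (t : R) (x : Rd) : Rd := vel S `[< Omin S t x >] t x.

Definition stress (b : bool) (t : R) (x : Rd) : 'M[R]_n.+1 :=
  let G := \matrix_(i, j) partial (W := R^o) j (fun y => vel S b t y ord0 i) x in
  visc S b *: (G + G^T) - (pres S b t x)%:M.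

(* n o a extends n constantly along normals, so its divergence on the
   interface is the sum of the principal curvatures. *)
Definition mean_curvature (t : R) (x : Rd) : R :=
  divergence (fun y => nrm S t (dproj S t y)) x.

Definition smooth_domain : Prop :=
  [/\ compact (Om S), Om S !=set0, closure (Om S)° = Om S
    & connected (Om S)°].

(* Gam is the evolving boundary of Omin, compactly inside Om; a defining
   function witnesses its regularity in space-time and orients the normal. *)
Definition smooth_interface (N : nat) : Prop :=
  exists phi : R -> Rd -> R,
    Ck (W := R^o) N (spacetime phi) /\
    forall t, 0 <= t <= Tend S ->
      [/\ Omin S t = [set x | phi t x < 0] /\ Omin S t !=set0,
          Gam S t = [set x | phi t x = 0],
          Omin S t `|` Gam S t `<=` (Om S)°
        & forall y, Gam S t y ->
            grad (phi t) y != 0 /\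
            nrm S t y = (enorm (grad (phi t) y))^-1 *: grad (phi t) y].

Definition smooth_projection (N : nat) : Prop :=
  [/\ 0 < width S,
      forall t x, 0 <= t <= Tend S -> tube (width S) t x ->
        [/\ Gam S t (dproj S t x),
            forall y, Gam S t y -> y != dproj S t x ->
              enorm (x - dproj S t x) < enorm (x - y)
          & exists s, x = dproj S t x + s *: nrm S t (dproj S t x)]
    & Ck_on N [set z : R^o * Rd | 0 <= z.1 <= Tend S /\ tube (width S) z.1 z.2]
        (spacetime (dproj S))].

Definition smooth_flowmap (N : nat) : Prop :=
  [/\ {in Om S, flowmap S 0 =1 id},
      forall t x, 0 < t < Tend S -> Om S x ->
        is_derive (t : R^o) (1 : R^o) (fun s : R^o => flowmap S s x)
          (velocity t (flowmap S t x)),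
      forall t, 0 <= t <= Tend S ->
        [/\ flowmap S t @` Om S = Om S, {in Om S &, injective (flowmap S t)},
            flowmap S t @` Gam S 0 = Gam S t
          & flowmap S t @` Omin S 0 = Omin S t]
    & forall b, Ck_on N
        [set z : R^o * Rd | 0 <= z.1 <= Tend S /\ closure (phase b 0) z.2]
        (spacetime (flowmap S))].

Definition two_phase_stokes (N : nat) : Prop :=
  [/\ forall b, [/\ 0 < visc S b, Ck N (spacetime (vel S b))
        & Ck (W := R^o) N (spacetime (pres S b))],
      0 < surf_tension S,
      forall b t x, 0 <= t <= Tend S -> (phase b t)° x ->
        divergence (vel S b t) x = 0 /\
        - (\row_i \sum_j partial (W := R^o) j (fun y => stress b t y i j) x) =
          force S b t x
    & forall t y, 0 <= t <= Tend S -> Gam S t y ->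
        vel S true t y = vel S false t y /\
        nrm S t y *m (stress false t y - stress true t y)^T =
          (surf_tension S * mean_curvature t y) *: nrm S t y].

Definition smooth_flow (N : nat) : Prop :=
  [/\ smooth_domain, 0 < Tend S, smooth_interface N & smooth_projection N] /\
  smooth_flowmap N /\ two_phase_stokes N.

(* f is the two-sided trace of v on Gam 0: the mean of |v - f o a| over
   shrinking tubes vanishes. *)
Definition is_trace (v f : Rd -> R) : Prop :=
  (forall eps, 0 < eps < width S ->
    measurable_fun (@rv R n.+1 @^-1` (tube eps 0 `\` Gam S 0))
      (fun t => v (rv t) - f (dproj S 0 (rv t)))) /\
  (fun eps : R => (eps^-1)%:E *
     \int[leb R n.+1]_(t in @rv R n.+1 @^-1` (tube eps 0 `\` Gam S 0))
       `|v (rv t) - f (dproj S 0 (rv t))|%:E)%E @ 0^'+ --> 0%E.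

Definition bulk0 : set Rd := (Om S)° `\` Gam S 0.

(* W^{s-1/q,q}(Gam 0) as the trace space of W^{s,q}(Om \ Gam 0), with the
   quotient norm. *)
Definition trace_norm (s : nat) (q : \bar R) (f : Rd -> R) : \bar R :=
  ereal_inf [set Wnorm s q bulk0 v | v in [set v | is_trace v f]].

(* The values of [E f] on Gam 0 are those of f, the other ones represent an
   element of W^{s,q}(Om \ Gam 0); E only looks at f on Gam 0. *)
Definition trace_extension (k : nat) (E : (Rd -> R) -> Rd -> R) : Prop :=
  [/\ forall f g, {in Gam S 0, f =1 g} -> E f = E g,
      forall q f g (c : R), (1 < q)%E ->
        (trace_norm 1 q f < +oo)%E -> (trace_norm 1 q g < +oo)%E ->
        {in Om S, E (fun y => c * f y + g y) =1 fun x => c * E f x + E g x},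
      forall f, {in Gam S 0, E f =1 f},
      forall q f, (1 < q)%E -> (trace_norm 1 q f < +oo)%E -> is_trace (E f) f
    & forall s q, (1 <= s <= k)%N -> (1 < q)%E ->
        exists2 c : R, 0 < c & forall f,
          (Wnorm s q bulk0 (E f) <= c%:E * trace_norm s q f)%E].

Definition cutoff (eta : Rd -> R) : Prop :=
  test_fun (Om S)° eta /\
  forall x, closure (Omin S 0) x -> \forall y \near x, eta y = 1.

End exact_flow.

(* A flat triangulation of a domain of R^(n.+1), with vertices [vtx]; [elt]
   lists the vertices of the elements, [inner] selects those of the inner
   subdomain, and [ifc] lists the vertices of the interface facets. *)
Record mesh (R : realType) (n nV nE nF : nat) := Mesh {
  vtx : 'I_nV -> 'rV[R]_n.+1;
  elt : 'I_nE -> 'I_n.+2 -> 'I_nV;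
  inner : {set 'I_nE};
  ifc : 'I_nF -> 'I_n.+1 -> 'I_nV
}.

(* A Lagrange node of degree k is the multi-index of its barycentric
   coordinates multiplied by k; its support is the set of vertices of the
   smallest simplex containing it. *)
Definition node (nV : nat) := {ffun 'I_nV -> nat}.

(* Multi-indices of the nodes of one r-simplex, in local numbering. *)
Definition loc_node (k r : nat) := {ffun 'I_r.+1 -> 'I_k.+1}.

Section reference_simplex.
Variables (R : realType) (k r : nat).

Definition ref_simplex : set 'rV[R]_r :=
  [set x | (forall i, 0 <= x ord0 i) /\ \sum_i x ord0 i <= 1].

Definition bary (x : 'rV[R]_r) (j : 'I_r.+1) : R :=
  if unlift ord0 j is Some i then x ord0 i else 1 - \sum_i x ord0 i.

Definition is_loc_node (b : loc_node k r) : bool := (\sum_j b j == k)%N.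

(* The polynomial of degree k equal to 1 at the node b and to 0 at the other
   nodes. *)
Definition lagrange (b : loc_node k r) (x : 'rV[R]_r) : R :=
  \prod_j \prod_(i < b j) ((k%:R * bary x j - i%:R) / i.+1%:R).

End reference_simplex.

Section cells.
Variables (R : realType) (n nV nE nF k : nat) (M : mesh R n nV nE nF).
Local Notation Rd := 'rV[R]_n.+1.
Local Notation node := (node nV).

(* An r-dimensional cell is given by its list of vertices. *)
Local Notation cell r := ('I_r.+1 -> 'I_nV).

Definition vset r (c : cell r) : {set 'I_nV} := [set c j | j : 'I_r.+1].

Definition flat r (c : cell r) (x : 'rV[R]_r) : Rd :=
  \sum_j bary x j *: vtx M (c j).

Definition flat_cell r (c : cell r) : set Rd := flat c @` @ref_simplex R r.

Definition edges r (c : cell r) : 'M[R]_(r, n.+1) :=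
  \matrix_i (vtx M (c (lift ord0 i)) - vtx M (c ord0)).

(* Reference coordinates of the orthogonal projection of y on the affine hull
   of a flat cell. *)
Definition ref_coord r (c : cell r) (y : Rd) : 'rV[R]_r :=
  (y - vtx M (c ord0)) *m (edges c)^T *m invmx (edges c *m (edges c)^T).

Definition glob_node r (c : cell r) (b : loc_node k r) : node :=
  [ffun v => (\sum_(j | c j == v) b j)%N].

Definition cell_node r (c : cell r) (z : node) : Prop :=
  exists2 b : loc_node k r, is_loc_node b & z = glob_node c b.

(* A finite element function is its nodal vector f, independently of the mesh
   on which it is realized; [fe c f] is its pull-back to the reference simplex
   of c.  Nodes are shared by adjacent cells, hence continuity, and S_h^k is
   the set of all such f. *)
Definition fe (W : lmodType R) r (c : cell r) (f : node -> W) (x : 'rV[R]_r) :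
    W :=
  \sum_(b : loc_node k r | is_loc_node b) lagrange b x *: f (glob_node c b).

(* The nodal vector of the identity of the flat mesh. *)
Definition flat_node (z : node) : Rd := \sum_v ((z v)%:R / k%:R) *: vtx M v.

(* f realized on the flat cell c and extended constantly in the normal
   directions: its full derivatives are the tangential derivatives of f. *)
Definition fe_flat m r (c : cell r) (f : node -> 'rV[R]_m) (y : Rd) :
    'rV[R]_m :=
  fe c f (ref_coord c y).

(* Volume element of the image of c under the parametrization F. *)
Definition vol_elt r (c : cell r) (F : node -> Rd) (x : 'rV[R]_r) : R :=
  let D := 'J (fe c F) x in Num.sqrt (\det (D *m D^T)).

Definition cell_int r (c : cell r) (F : node -> Rd) (g : 'rV[R]_r -> R) : R :=
  \int[leb R r]_(t in @rv R r @^-1` @ref_simplex R r)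
    (g (rv t) * vol_elt c F (rv t)).

Section families.
Variables (r : nat) (I : finType) (c : I -> cell r).

Definition ref_points : set (I * 'rV[R]_r) := [set z | ref_simplex z.2].

(* L^q norm over the mesh with cells c parametrized by F, for functions that
   are continuous on each closed cell. *)
Definition fe_Lnorm (F : node -> Rd) (q : \bar R) (g : I -> 'rV[R]_r -> R) :
    \bar R :=
  match q with
  | q'%:E =>
    ((\sum_i \int[leb R r]_(t in @rv R r @^-1` @ref_simplex R r)
       (`|g i (rv t)| `^ q' * vol_elt (c i) F (rv t))%:E) `^ q'^-1)%E
  | +oo%E => maxe 0%E (ereal_sup [set `|g z.1 z.2|%:E | z in ref_points])
  | -oo%E => 0%E
  end.

(* Elementwise Sobolev norm over the flat mesh. *)
Definition fe_Wnorm m (s : nat) (q : \bar R) (f : node -> 'rV[R]_m) : \bar R :=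
  let N l := fe_Lnorm flat_node q
    (fun i x => tensor_norm l (fe_flat (c i) f) (flat (c i) x)) in
  match q with
  | q'%:E => ((\sum_(l < s.+1) N l `^ q') `^ q'^-1)%E
  | _ => \big[maxe/0%E]_(l < s.+1) N l
  end.

(* F is injective as a map on the flat mesh. *)
Definition injective_mesh (F : node -> Rd) : Prop :=
  forall z z', ref_points z -> ref_points z' ->
    fe (c z.1) F z.2 = fe (c z'.1) F z'.2 ->
    flat (c z.1) z.2 = flat (c z'.1) z'.2.

(* Operator norm, at the image of x, of the (tangential) gradient of the
   inverse of F : v *m edges c is the flat tangent vector with reference
   coordinates v, and F maps it to v *m 'J (fe c F) x. *)
Definition inv_grad_norm (i : I) (F : node -> Rd) (x : 'rV[R]_r) : \bar R :=
  ereal_inf [set L%:E | L in [set L : R | 0 <= L /\ forall v : 'rV[R]_r,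
    enorm (v *m edges (c i)) <= L * enorm (v *m 'J (fe (c i) F) x)]].

Definition inv_W1norm (F : node -> Rd) : \bar R :=
  if `[< injective_mesh F >] then
    maxe (ereal_sup [set (enorm (flat (c z.1) z.2))%:E | z in ref_points])
         (ereal_sup [set inv_grad_norm z.1 F z.2 | z in ref_points])
  else +oo%E.

Definition omega (F : node -> Rd) : \bar R :=
  (fe_Wnorm k.-1 4%:E F + fe_Wnorm k.-2 +oo F + inv_W1norm F)%E.

Definition omega_star (F : node -> Rd) : \bar R := fe_Wnorm k 2%:E F.

End families.

Definition mesh_size : R :=
  \big[Num.max/0]_(e < nE) \big[Num.max/0]_i \big[Num.max/0]_j
    enorm (vtx M (elt M e i) - vtx M (elt M e j)).

(* Shape regularity and quasi-uniformity in one condition: every element has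
   diameter at most h and contains a ball of radius h / sigma. *)
Definition quasi_uniform (sigma : R) : Prop :=
  forall e, exists x0, forall x,
    enorm (x - x0) <= mesh_size / sigma -> flat_cell (elt M e) x.

Definition ifc_node (z : node) : Prop := exists i, cell_node (ifc M i) z.

Definition bulk_node (z : node) : Prop := exists e, cell_node (elt M e) z.

Definition bd_facet (c : cell n) : Prop :=
  injective c /\ #|[set e | vset c \subset vset (elt M e)]| = 1%N.

Definition bd_node (z : node) : Prop :=
  exists2 c, bd_facet c & cell_node c z.

Definition conforming : Prop :=
  [/\ injective (vtx M), forall e, injective (elt M e),
      forall e, row_free (edges (elt M e)),
      injective (fun e => vset (elt M e))
    & forall e e' x x', ref_simplex x -> ref_simplex x' ->
        flat (elt M e) x = flat (elt M e') x' ->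
        forall j, 0 < bary x j -> elt M e j \in vset (elt M e')].

(* The interface facets are the facets between an inner and an outer
   element. *)
Definition interface_facets : Prop :=
  [/\ forall i, injective (ifc M i), injective (fun i => vset (ifc M i)),
      forall i, exists e e', [/\ e \in inner M, e' \notin inner M
        & vset (ifc M i) = vset (elt M e) :&: vset (elt M e')]
    & forall e e', e \in inner M -> e' \notin inner M ->
        #|vset (elt M e) :&: vset (elt M e')| = n.+1 ->
        exists i, vset (ifc M i) = vset (elt M e) :&: vset (elt M e')].

Variable S : flow R n.

Definition fitted : Prop :=
  [/\ forall i j, Gam S 0 (vtx M (ifc M i j)),
      forall e j, e \in inner M -> (Omin S 0 `|` Gam S 0) (vtx M (elt M e j)),
      forall e j, e \notin inner M -> ~ Omin S 0 (vtx M (elt M e j)),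
      \bigcup_i flat_cell (ifc M i) `<=` tube S (width S) 0
    & set_bij (\bigcup_i flat_cell (ifc M i)) (Gam S 0) (dproj S 0)].

Definition fitted_triangulation : Prop :=
  [/\ \bigcup_e flat_cell (elt M e) = Om S, conforming, interface_facets
    & fitted].

Definition ifc_vertex (v : 'I_nV) : bool := [exists i, v \in vset (ifc M i)].

Definition image_cell r (c : cell r) (F : node -> Rd) : set Rd :=
  fe c F @` @ref_simplex R r.

(* F0 parametrizes the curved isoparametric mesh at time 0 over the flat one;
   only elements with an edge or a facet on the interface are deformed. *)
Definition lenoir_mesh (F0 : node -> Rd) : Prop :=
  [/\ forall z, ifc_node z -> F0 z = dproj S 0 (flat_node z),
      forall e, (#|[set j | ifc_vertex (elt M e j)]| <= 1)%N ->
        forall z, cell_node (elt M e) z -> F0 z = flat_node z,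
      injective_mesh (elt M) F0
    & \bigcup_i image_cell (ifc M i) F0 `<=` tube S (width S) 0].

Definition lenoir_lift (F0 : node -> Rd) (Phi0 : Rd -> Rd) : Prop :=
  let D := \bigcup_e image_cell (elt M e) F0 in
  [/\ {within D, continuous Phi0}, set_bij D (Om S) Phi0,
      forall e, Ck_on k.+1 (image_cell (elt M e) F0) Phi0,
      Phi0 @` (\bigcup_(e in [set e | e \in inner M]) image_cell (elt M e) F0)
        = Omin S 0 `|` Gam S 0
    & forall i, {in image_cell (ifc M i) F0, Phi0 =1 dproj S 0}].

(* The cell attached to a node by the Scott--Zhang interpolation. *)
Record sz_choice := SZChoice {
  sz_ifc : node -> 'I_nF;
  sz_bd : node -> cell n;
  sz_elt : node -> 'I_nE
}.

Definition sz_admissible (sz : sz_choice) : Prop :=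
  forall z,
    [/\ ifc_node z -> cell_node (ifc M (sz_ifc sz z)) z,
        bd_node z -> bd_facet (sz_bd sz z) /\ cell_node (sz_bd sz z) z
      & bulk_node z -> cell_node (elt M (sz_elt sz z)) z].

(* w is the integral of v over the cell c, realized by F0, against the L^2 dual
   basis function of the node z. *)
Definition sz_value r (c : cell r) (F0 : node -> Rd) (v : Rd -> R) (z : node)
    (w : R) : Prop :=
  exists2 psi : node -> R^o,
    forall g : node -> R^o,
      cell_int c F0 (fun x => fe c psi x * fe c g x) = g z &
    w = cell_int c F0 (fun x => fe c psi x * v (fe c F0 x)).

(* Nodes on the interface are averaged over an interface facet, so that the
   interpolations on both subdomains agree there; the remaining nodes belong
   to elements of a single subdomain. *)
Definition scott_zhang (sz : sz_choice) (F0 : node -> Rd) (v : Rd -> R)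
    (w : node -> R) : Prop :=
  forall z, bulk_node z ->
    [/\ ifc_node z -> sz_value (ifc M (sz_ifc sz z)) F0 v z (w z),
        bd_node z -> sz_value (sz_bd sz z) F0 v z (w z)
      & ~ ifc_node z -> ~ bd_node z ->
        sz_value (elt M (sz_elt sz z)) F0 v z (w z)].

(* w = E_h f, componentwise; ft is f o (a^0 restricted to the curved discrete
   interface)^-1, which only matters on Gam 0. *)
Definition is_Eh (E : (Rd -> R) -> Rd -> R) (eta : Rd -> R)
    (sz : sz_choice) (F0 : node -> Rd) (Phi0 : Rd -> Rd)
    m (f w : node -> 'rV[R]_m) : Prop :=
  forall l : 'I_m, exists2 ft : Rd -> R,
    forall i x, ref_simplex x ->
      ft (dproj S 0 (fe (ifc M i) F0 x)) = fe (ifc M i) f x ord0 l &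
    scott_zhang sz F0 (fun y => eta (Phi0 y) * E ft (Phi0 y))
      (fun z => w z ord0 l).

(* Nodal vectors on the interface at time t, from the numerical mesh X. *)
Definition Xhat_ifc (t : R) (X : node -> Rd) (z : node) : Rd := dproj S t (X z).

Definition ehat (t : R) (X : node -> Rd) (z : node) : Rd :=
  X z - Xhat_ifc t X z.

(* X - I_h (X^m o Phi^0), for the interpolation on the mesh realized by F0. *)
Definition esharp (t : R) (F0 : node -> Rd) (Phi0 : Rd -> Rd)
    (X : node -> Rd) (z : node) : Rd :=
  X z - flowmap S t (Phi0 (F0 z)).

Definition induction_hypothesis (t : R) (F0 : node -> Rd) (Phi0 : Rd -> Rd)
    (X Ehe : node -> Rd) : Prop :=
  let h := mesh_size in
  let c1 := (h^-1)%:E in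
  let c2 := (h `^ (- (3 / 2)))%:E in
  let e := ehat t X in
  (c1 * fe_Wnorm (elt M) 1 +oo Ehe + c2 * fe_Wnorm (elt M) 1 2%:E Ehe
   + c1 * fe_Wnorm (ifc M) 1 +oo e + c2 * fe_Wnorm (ifc M) 1 2%:E e
   + c2 * fe_Wnorm (elt M) 1 2%:E (esharp t F0 Phi0 X) <= 1)%E.

(* Integral of f g over the interface mesh parametrized by F. *)
Definition surf_int (F : node -> Rd) (f g : node -> R^o) : R :=
  \sum_i cell_int (ifc M i) F (fun x => fe (ifc M i) f x * fe (ifc M i) g x).

(* L^p norms over the interface mesh parametrized by F. *)
Definition surf_norm (F : node -> Rd) (p : \bar R) (f : node -> R^o) : \bar R :=
  fe_Lnorm (ifc M) F p (fun i x => fe (ifc M i) f x).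

Definition surf_vnorm (F : node -> Rd) (p : \bar R) (f : node -> Rd) : \bar R :=
  fe_Lnorm (ifc M) F p (fun i x => enorm (fe (ifc M i) f x)).

End cells.

(* Main.v *)
Require Import Defs.
From HB Require Import structures.
From mathcomp Require Import all_boot all_order all_algebra.
From mathcomp Require Import all_classical all_reals all_analysis.
From mathcomp Require Import perm measurable_realfun.
From mathcomp Require Import ring lra.

Set Implicit Arguments.
Unset Strict Implicit.
Unset Printing Implicit Defensive.

Import Order.TTheory GRing.Theory Num.Theory.
Import numFieldNormedType.Exports.

Local Open Scope classical_set_scope.
Local Open Scope ring_scope.

(** Why the estimate holds.

    The two surfaces are parametrized over the same reference simplices, so the
    difference of the integrals is the integral of f g times the difference of two
    volume elements.  A volume element is the square root of a Gram determinant,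
    and if A and B are the Jacobians, in reference coordinates, of the projected
    surface and of the error e, its relative change is controlled by
    h^-2 |A B^T| and h^-2 |B B^T| ([gram_vol_diff]).  Estimating these products by
    the norms of their factors would leave a derivative of e, and an inverse
    estimate for it would cost a factor 1/h.

    This factor is gained back because nodal errors are normal to the interface.
    The shape functions sum to 1 ([lagrange_unity]), so the rows of A are
    combinations of chords Q(z) - Q(w) between nodes, while those of B are
    combinations of the nodal errors e(w).  Nodes of the projected surface lie on
    the smooth interface, and e(w) is normal to it at Q(w), whence
    |(Q(z) - Q(w)) . e(w)| <= C h^2 |e(w)| ([chord_normal], [cross_le]).
    The bound |B| <= C h^2 contained in the induction hypothesis settles B B^T
    ([square_le]).  Hence the change of the volume element on a facet is at most
    C h^n times the largest nodal error there ([vol_elt_diff]).  The bounds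
    A = O(h) and |v A| >= c h |v| that make these estimates uniform come from the
    constant nu and from the shape regularity of the mesh ([facet_JQ_le],
    [facet_JQ_ge]).

    It remains to sum over the facets.  Each facet contributes at most C h^n times
    the product of the largest nodal values of e, f and g, and the sum is treated
    by a discrete Hoelder inequality with three exponents ([dnorm_hoelder]).  The
    discrete norms are dominated by the norms over the surface, uniformly in the
    exponents, because a polynomial of bounded degree stays above half of its
    largest nodal value on a cube of fixed size ([fe_near_max],
    [fe_Lnorm_ge]). *)

(** * Lagrange shape functions on the reference simplex *)

Section binomial_polynomials.
Variable R : realType.

(** The binomial coefficient of a real number: shape functions of degree k are
    products of such coefficients, taken at k times the barycentric
    coordinates. *)
Definition gbin (y : R) (m : nat) : R := \prod_(i < m) ((y - i%:R) / i.+1%:R).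

Lemma gbinS y m : m.+1%:R * gbin y m.+1 = (y - m%:R) * gbin y m.
Proof.
have m0 : m.+1%:R != 0 :> R by rewrite pnatr_eq0.
by rewrite /gbin big_ord_recr/= mulrCA [_ * (_ / _)]mulrC mulfVK// mulrC.
Qed.

Lemma gbin0 y : gbin y 0 = 1.
Proof. by rewrite /gbin big_ord0. Qed.

Lemma gbin_nat m b : (m < b)%N -> gbin m%:R b = 0.
Proof. by move=> mb; rewrite /gbin (bigD1 (Ordinal mb))//= subrr !mul0r. Qed.

Lemma gbin_diag m : gbin m%:R m = 1.
Proof.
elim: m => [|m IH]; first exact: gbin0.
apply: (@mulfI _ m.+1%:R); first by rewrite pnatr_eq0.
rewrite /gbin big_ord_recl /= subr0 divr1 mulr1.
under eq_bigr => i _ do rewrite /bump/= add1n -natr1 -(natr1 i) opprD addrACA subrr addr0.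
have -> : \prod_(i < m) ((m%:R - i%:R) / i.+2%:R : R) =
   \prod_(i < m) ((m%:R - i%:R) / i.+1%:R) * \prod_(i < m) (i.+1%:R / i.+2%:R).
  rewrite -big_split/=; apply: eq_bigr => i _.
  by rewrite mulrA mulfVK// pnatr_eq0.
rewrite -/(gbin _ _) IH mul1r mulrA.
have -> : \prod_(i < m) (i.+1%:R / i.+2%:R : R) = m.+1%:R^-1.
  elim: m {IH} => [|m IH]; first by rewrite big_ord0 invr1.
  by rewrite big_ord_recr/= IH mulrA mulVf ?pnatr_eq0// mul1r.
by rewrite mulfK// pnatr_eq0.
Qed.

(** The Chu--Vandermonde identity: multiplied by m + 1, it is the recursion
    [gbinS] applied to either factor of each summand. *)
Lemma gbinD y z m :
  gbin (y + z) m = \sum_(i < m.+1) gbin y i * gbin z (m - i).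
Proof.
elim: m => [|m IH]; first by rewrite big_ord_recl big_ord0 !gbin0 mulr1 addr0.
apply: (@mulfI _ m.+1%:R); first by rewrite pnatr_eq0.
rewrite gbinS IH !mulr_sumr.
transitivity (\sum_(i < m.+2) (i%:R * gbin y i * gbin z (m.+1 - i)
     + gbin y i * ((m.+1 - i)%:R * gbin z (m.+1 - i)))); last first.
  apply: eq_bigr => i _.
  have -> : m.+1%:R = i%:R + (m.+1 - i)%:R :> R.
    by rewrite -natrD subnKC// -ltnS.
  by ring.
rewrite [in RHS]big_split/= [X in _ = X + _]big_ord_recl/= !mul0r add0r.
rewrite [X in _ = _ + X]big_ord_recr/=.
rewrite subnn mul0r mulr0 addr0 -big_split/=.
apply: eq_bigr => i _; rewrite /bump/= add1n gbinS subSS.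
rewrite (subSn (_ : i <= m)%N); last by rewrite -ltnS.
rewrite gbinS natrB; last by rewrite -ltnS.
by ring.
Qed.

(** Both sides are the coefficient of X^k in the product over j of the binomial
    series of exponents y j, truncated at degree k. *)
Lemma gbin_sum (J : finType) (y : J -> R) k :
  \sum_(b : {ffun J -> 'I_k.+1} | (\sum_j b j == k)%N) \prod_j gbin (y j) (b j) =
  gbin (\sum_j y j) k.
Proof.
pose P z : {poly R} := \sum_(i < k.+1) gbin z i *: 'X^i.
have PE z m : (m <= k)%N -> (P z)`_m = gbin z m.
  move=> mk; rewrite /P -(poly_def k.+1 (gbin z)) coef_poly ltnS mk//.
have key : forall m, (m <= k)%N -> (\prod_j P (y j))`_m = gbin (\sum_j y j) m.
  pose K (p : {poly R}) z := forall m, (m <= k)%N -> p`_m = gbin z m.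
  apply: (big_rec2 K) => [m _|j z p _ IH m mk].
    rewrite coef1; case: m => [|m]; first by rewrite gbin0.
    by rewrite -[X in gbin X _](mulr0n 1) gbin_nat.
  rewrite coefM gbinD; apply: eq_bigr => i _.
  by rewrite PE ?IH//; [apply: leq_trans mk; rewrite leq_subr|
    apply: leq_trans mk; rewrite -ltnS].
rewrite -key// /P bigA_distr_bigA/= coef_sum [LHS]big_mkcond/=.
apply: eq_bigr => b _.
rewrite scaler_prod -expr_sum coefZ coefXn [k == _]eq_sym.
by case: eqP => _; rewrite ?mulr1// mulr0.
Qed.

End binomial_polynomials.

Section lagrange_basis.
Variables (R : realType) (k r : nat).
Hypothesis k0 : (0 < k)%N.

Lemma sum_bary (x : 'rV[R]_r) : \sum_j bary x j = 1.
Proof.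
rewrite big_ord_recl /bary unlift_none.
by rewrite [X in _ + X](eq_bigr (fun i => x ord0 i)) ?subrK// => i _; rewrite liftK.
Qed.

Lemma lagrange_gbin (b : loc_node k r) (x : 'rV[R]_r) :
  Defs.lagrange b x = \prod_j gbin (k%:R * bary x j) (b j).
Proof. by []. Qed.

(** This is [gbin_sum] because the barycentric coordinates have sum 1. *)
Lemma lagrange_unity (x : 'rV[R]_r) :
  \sum_(b : loc_node k r | is_loc_node b) Defs.lagrange b x = 1.
Proof.
under eq_bigr => b _ do rewrite lagrange_gbin.
by rewrite gbin_sum -mulr_sumr sum_bary mulr1 gbin_diag.
Qed.

Definition loc_pt (b : loc_node k r) : 'rV[R]_r :=
  \row_i ((b (lift ord0 i))%:R / k%:R).

Lemma bary_loc_pt (b : loc_node k r) j :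
  is_loc_node b -> k%:R * bary (loc_pt b) j = (b j)%:R.
Proof.
move=> /eqP bk; have k0' : k%:R != 0 :> R by rewrite pnatr_eq0 -lt0n.
rewrite /bary; case: unliftP => [i ->|->].
  by rewrite mxE mulrC mulfVK.
rewrite mulrBr mulr1 mulr_sumr -{1}bk big_ord_recl natrD natr_sum.
rewrite [X in _ - X](_ : _ = \sum_i (b (lift ord0 i))%:R) ?addrK//.
by apply: eq_bigr => i _; rewrite mxE mulrC mulfVK.
Qed.

Lemma ref_simplex_bary (x : 'rV[R]_r) :
  ref_simplex x <-> forall j, 0 <= bary x j.
Proof.
split=> [[x0 x1] j|H].
  by rewrite /bary; case: unliftP => [i _|_]; rewrite ?subr_ge0.
split=> [i|]; first by have := H (lift ord0 i); rewrite /bary liftK.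
by have := H ord0; rewrite /bary unlift_none subr_ge0.
Qed.

Lemma loc_pt_simplex (b : loc_node k r) :
  is_loc_node b -> ref_simplex (loc_pt b).
Proof.
move=> bk; apply/ref_simplex_bary => j.
have k0' : 0 < k%:R :> R by rewrite ltr0n.
by rewrite -(pmulr_rge0 _ k0') bary_loc_pt.
Qed.

Lemma lagrange_loc_pt (b c : loc_node k r) :
  is_loc_node b -> is_loc_node c -> Defs.lagrange b (loc_pt c) = (b == c)%:R.
Proof.
move=> bk ck; rewrite lagrange_gbin.
under eq_bigr => j _ do rewrite bary_loc_pt//.
have [->|bc] := eqVneq b c; first by rewrite big1// => j _; exact: gbin_diag.
(* Both multi-indices have sum k, so one that differs from b is smaller than b
   somewhere. *)
have [j cbj] : exists j, (c j < b j)%N.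
  apply/not_existsP => H; move/eqP: bc; apply.
  have le j : (b j <= c j)%N by rewrite leqNgt; apply/negP/H.
  have := leqif_sum (fun j (_ : true) => conj (le j) (erefl (b j == c j :> nat))).
  rewrite /is_loc_node in bk ck; move/eqP: bk => ->; move/eqP: ck => -> [_].
  rewrite eqxx => /esym/forallP H'; apply/ffunP => j; apply/val_inj/eqP.
  exact: (implyP (H' j)).
by rewrite (bigD1 j)//= gbin_nat// mul0r.
Qed.

End lagrange_basis.

(** * Determinants of coercive matrices *)

Section determinants.
Variable R : realType.

Lemma prod_lipschitz (I : Type) (s : seq I) (a b : I -> R) (K d : R) :
  1 <= K -> (forall i, `|a i| <= K) -> (forall i, `|b i| <= K) ->
  (forall i, `|a i - b i| <= d) ->
  `|\prod_(i <- s) a i - \prod_(i <- s) b i| <= (size s)%:R * K ^+ size s * d.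
Proof.
move=> K1 aK bK abd; have K0 : 0 <= K by apply: le_trans K1.
elim: s => [|i s IH]; first by rewrite !big_nil subrr normr0 !mul0r.
have d0 : 0 <= d by exact: le_trans (abd i).
have Bs : `|\prod_(j <- s) b j| <= K ^+ size s.
  elim: s {IH} => [|j s IHs]; first by rewrite big_nil normr1.
  by rewrite big_cons normrM exprS ler_pM.
rewrite !big_cons /=; set A := \prod_(j <- s) a j; set B := \prod_(j <- s) b j.
have -> : a i * A - b i * B = a i * (A - B) + (a i - b i) * B by ring.
rewrite (le_trans (ler_normD _ _))// !normrM -natr1 !mulrDl mul1r exprS.
apply: lerD.
  by rewrite (_ : _ * _ * d = K * ((size s)%:R * K ^+ size s * d)); [exact: ler_pM|ring].
rewrite mulrC; apply: ler_pM => //.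
apply: (le_trans Bs); rewrite -[leLHS]mul1r; apply: ler_wpM2r => //.
exact: exprn_ge0.
Qed.

Lemma sum_perm_const n (x : R) : n`!%:R * x = \sum_(s : 'S_n) x.
Proof. by rewrite sumr_const card_Sn mulr_natl. Qed.

Lemma det_lipschitz n (A B : 'M[R]_n) (K d : R) :
  1 <= K -> (forall i j, `|A i j| <= K) -> (forall i j, `|B i j| <= K) ->
  (forall i j, `|A i j - B i j| <= d) ->
  `|\det A - \det B| <= n`!%:R * (n%:R * K ^+ n * d).
Proof.
move=> K1 AK BK ABd; rewrite /determinant -sumrB (le_trans (ler_norm_sum _ _ _))//.
rewrite sum_perm_const; apply: ler_sum => s _.
rewrite -mulrBr normrMsign.
have := @prod_lipschitz _ (index_enum 'I_n) (fun i => A i (s i))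
   (fun i => B i (s i)) K d K1 (fun i => AK _ _) (fun i => BK _ _) (fun i => ABd _ _).
by rewrite [index_enum _]unlock -enumT size_enum_ord.
Qed.

Lemma det_le n (A : 'M[R]_n) (K : R) :
  (forall i j, `|A i j| <= K) -> `|\det A| <= n`!%:R * K ^+ n.
Proof.
move=> AK; rewrite /determinant (le_trans (ler_norm_sum _ _ _))//.
rewrite sum_perm_const; apply: ler_sum => s _.
rewrite normrMsign normr_prod -[X in _ ^+ X]card_ord -prodr_const.
by apply: ler_prod => i _; rewrite normr_ge0 AK.
Qed.

Definition coercive n (c : R) (G : 'M[R]_n) : Prop :=
  forall v : 'rV[R]_n, c * \sum_i v ord0 i ^+ 2 <= (v *m G *m v^T) ord0 ord0.

Lemma sum_sqr_eq0 n (v : 'rV[R]_n) : \sum_i v ord0 i ^+ 2 <= 0 -> v = 0.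
Proof.
move=> v0; apply/rowP => i; rewrite mxE; apply/eqP.
rewrite -sqrf_eq0 eq_le sqr_ge0 andbT.
apply: le_trans v0; rewrite (bigD1 i)//= lerDl.
by apply: sumr_ge0 => j _; exact: sqr_ge0.
Qed.

Lemma coercive_unitmx n (c : R) (G : 'M[R]_n) :
  0 < c -> coercive c G -> G \in unitmx.
Proof.
move=> c0 cG; rewrite -row_free_unit -kermx_eq0.
apply/negPn/negP => /rowV0Pn[v /sub_kermxP vG0 /eqP]; apply.
have := cG v; rewrite vG0 mul0mx mxE pmulr_rle0//; exact: sum_sqr_eq0.
Qed.

(** The positivity of the determinant follows from that of the identity by
    deforming one matrix into the other: coercivity, hence invertibility, is
    preserved along the segment. *)
Lemma coercive_det_gt0 n (c : R) (G : 'M[R]_n) :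
  0 < c -> coercive c G -> 0 < \det G.
Proof.
move=> c0 cG.
pose p : {poly R} := \det (map_mx polyC (c%:M) + 'X *: map_mx polyC (G - c%:M)).
have pE t : p.[t] = \det (c%:M + t *: (G - c%:M)).
  rewrite -[LHS]/(horner_eval t p) -det_map_mx; congr (\det _).
  by apply/matrixP => i j; rewrite !mxE /= horner_evalE hornerD hornerM hornerX !hornerC.
have p_neq0 (t : R) : 0 <= t -> t <= 1 -> p.[t] != 0.
  move=> t0 t1; rewrite pE -unitfE -unitmxE; apply: (coercive_unitmx c0) => v.
  have -> : c%:M + t *: (G - c%:M) = t *: G + (1 - t) *: c%:M.
    by rewrite scalerBr scalerBl scale1r addrCA.
  rewrite mulmxDr mulmxDl mxE -!scalemxAr -!scalemxAl mul_mx_scalar -scalemxAl.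
  rewrite !mxE -[leLHS](mul1r) -{1}(subrK t 1) mulrDl addrC.
  apply: lerD; last by apply: ler_wpM2l => //; have := cG v; rewrite mxE.
  apply: ler_wpM2l; first by rewrite subr_ge0.
  apply: ler_wpM2l; first exact: ltW.
  by apply: ler_sum => i _; rewrite !mxE expr2.
have p0 : 0 < p.[0] by rewrite pE scale0r addr0 det_scalar exprn_gt0.
have p1 : p.[1] = \det G by rewrite pE scale1r addrCA subrr addr0.
rewrite -p1 ltNge; apply/negP => p1le.
have [|t] := @poly_ivt R (- p) 0 1 ler01.
  by rewrite !hornerN oppr_le0 oppr_ge0 (ltW p0) p1le.
move=> /andP[t0 t1]; rewrite rootN /root.
by apply/negP/p_neq0.
Qed.

(** Coercivity bounds the entries of the inverse matrix, hence the inverse of the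
    determinant. *)
Lemma coercive_det_ge n (c : R) (G : 'M[R]_n) :
  0 < c -> coercive c G -> c ^+ n / n`!%:R <= \det G.
Proof.
move=> c0 cG; have dG := coercive_det_gt0 c0 cG; have uG := coercive_unitmx c0 cG.
have inv_le i j : `|invmx G i j| <= c^-1.
  have := cG (row i (invmx G)).
  rewrite -row_mul mulVmx// => H.
  have E : (row i 1%:M *m (row i (invmx G))^T) ord0 ord0 = invmx G i i.
    move: (invmx G) => V; rewrite mxE (bigD1 i)//= big1.
      by rewrite addr0 !mxE eqxx mulr1n mul1r.
    by move=> l li; rewrite !mxE eq_sym (negbTE li) mul0r.
  rewrite {}E in H.
  have S l : c * invmx G i l ^+ 2 <= invmx G i i.
    apply: le_trans H; apply: ler_wpM2l; first exact: ltW.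
    rewrite (bigD1 l)//= mxE lerDl.
    by apply: sumr_ge0 => l' _; exact: sqr_ge0.
  have ii0 : 0 <= invmx G i i.
    by apply: le_trans (S i); rewrite mulr_ge0 ?sqr_ge0// ltW.
  have iic : invmx G i i <= c^-1.
    have := S i; rewrite le_eqVlt in ii0; case/orP: ii0 => [/eqP <- _|ii0].
      by rewrite invr_ge0 ltW.
    rewrite expr2 mulrA -{3}[invmx G i i]mul1r ler_pM2r// => H'.
    by rewrite -[leRHS]mulr1 ler_pdivlMl.
  rewrite -(@ler_pXn2r _ 2)// ?nnegrE ?normr_ge0 ?invr_ge0 ?(ltW c0)// real_normK ?num_real//.
  have := le_trans (S j) iic; rewrite -ler_pdivlMl// => /le_trans; apply.
have := det_le inv_le; rewrite det_inv ger0_norm ?invr_ge0 ?(ltW dG)//.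
have f0 : (0 : R) < n`!%:R by rewrite ltr0n fact_gt0.
rewrite -[leRHS]invrK lef_pV2 ?posrE ?invr_gt0//; last by rewrite mulr_gt0// ?exprn_gt0 ?invr_gt0.
by rewrite invrM ?unitfE ?gt_eqF// ?exprn_gt0 ?invr_gt0// -exprVn invrK.
Qed.

Lemma sqrt_diff_le (a b : R) :
  0 < b -> `|Num.sqrt a - Num.sqrt b| * Num.sqrt b <= `|a - b|.
Proof.
move=> b0; have sb := sqrtr_ge0 b; have := sqr_sqrtr (ltW b0) => Eb.
have [a0|a0] := leP 0 a.
  have -> : a - b = (Num.sqrt a - Num.sqrt b) * (Num.sqrt a + Num.sqrt b).
    by rewrite -subr_sqr !sqr_sqrtr// ltW.
  rewrite normrM; apply: ler_wpM2l => //.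
  by rewrite ger0_norm ?addr_ge0 ?sqrtr_ge0// lerDr sqrtr_ge0.
rewrite ltr0_sqrtr// sub0r normrN ger0_norm// -expr2 Eb.
by rewrite ltr0_norm ?subr_lt0 ?(lt_trans a0)// opprB lerDl oppr_ge0 ltW.
Qed.

End determinants.

(** * Discrete Hoelder inequality *)

Section discrete_hoelder.
Variable R : realType.

Lemma powR_le_exp (u s t : R) : 0 < s -> 0 <= u -> 0 <= t ->
  u `^ t <= s `^ t * expR (t * (u / s - 1)).
Proof.
move=> s0 u0 t0; have [->|tn0] := eqVneq t 0.
  by rewrite !powRr0 mul0r expR0 mulr1.
have [->|un0] := eqVneq u 0.
  by rewrite powR0// mulr_ge0 ?powR_ge0 ?expR_ge0.
have up : 0 < u by rewrite lt_def un0.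
rewrite -{1}(mulfVK (lt0r_neq0 s0) u) mulrC powRM ?divr_ge0 ?(ltW s0)//.
apply: ler_wpM2l; first exact: powR_ge0.
rewrite [t * _]mulrC expRM ge0_ler_powR ?nnegrE ?expR_ge0 ?divr_ge0 ?(ltW s0)//.
have := expR_ge1Dx (u / s - 1); by rewrite addrC subrK.
Qed.

(** Compare the exponential with its tangent at 0 for the ratio of each number to
    the weighted mean S.  As S may vanish, S + d stands in for it. *)
Lemma weighted_amgm (u v w t1 t2 t3 : R) : 0 <= u -> 0 <= v -> 0 <= w ->
  0 <= t1 -> 0 <= t2 -> 0 <= t3 -> t1 + t2 + t3 = 1 ->
  u `^ t1 * v `^ t2 * w `^ t3 <= t1 * u + t2 * v + t3 * w.
Proof.
move=> u0 v0 w0 t10 t20 t30 t1E; apply/ler_addgt0Pr => d d0.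
set S := t1 * u + t2 * v + t3 * w; have S0 : 0 <= S by rewrite !addr_ge0 ?mulr_ge0.
have s0 : 0 < S + d by rewrite ltr_wpDl.
have : S <= S + d by rewrite lerDl ltW.
move: (S + d) s0 => s s0 Ss.
apply: (@le_trans _ _ ((s `^ t1 * expR (t1 * (u / s - 1))) *
   (s `^ t2 * expR (t2 * (v / s - 1))) * (s `^ t3 * expR (t3 * (w / s - 1))))).
  by rewrite !ler_pM ?mulr_ge0 ?powR_ge0 ?powR_le_exp.
rewrite (_ : _ * _ * _ = (s `^ t1 * s `^ t2 * s `^ t3) *
  (expR (t1 * (u / s - 1)) * expR (t2 * (v / s - 1)) * expR (t3 * (w / s - 1)))); last by ring.
have sn0 : s != 0 by exact: lt0r_neq0.
rewrite -!powRD ?sn0 ?implybT// t1E powRr1 ?(ltW s0)// -!expRD.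
rewrite -[leRHS]mulr1 ler_pM2l// -[leRHS]expR0 ler_expR.
have -> : t1 * (u / s - 1) + t2 * (v / s - 1) + t3 * (w / s - 1) =
  S / s - (t1 + t2 + t3) by rewrite /S; ring.
by rewrite t1E subr_le0 ler_pdivrMr// mul1r.
Qed.

Variables (I : finType) (W : R).
Hypothesis W0 : 0 <= W.

(** The L^p norm of a function that is constant on cells of common measure W.
    For a quasi-uniform mesh W can be taken as a power of h. *)
Definition dnorm (p : \bar R) (a : I -> R) : R :=
  if p is p'%:E then (\sum_i W * a i `^ p') `^ p'^-1
  else \big[Num.max/0]_i a i.

Lemma dnorm_ge0 p a : (forall i, 0 <= a i) -> 0 <= dnorm p a.
Proof. by case: p => [p||] a0; rewrite ?powR_ge0//; apply: bigmax_ge_id. Qed.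

Lemma dnorm_eq0 (p : \bar R) a : (1 <= p)%E -> (forall i, 0 <= a i) ->
  dnorm p a = 0 -> forall i, W * a i = 0.
Proof.
case: p => [p||//]/= p1 a0; last first.
  move=> m0 i; have := le_bigmax 0 a i; rewrite m0 => ai.
  by rewrite (_ : a i = 0) ?mulr0//; apply/eqP; rewrite eq_le ai a0.
rewrite lee_fin in p1.
have p0 : p != 0 by apply: lt0r_neq0; apply: lt_le_trans p1.
move=> /eqP; rewrite powR_eq0 => /andP[/eqP S0 _] i.
have /eqP : W * a i `^ p = 0.
  by move/psumr_eq0P : S0 => -> // j _; rewrite mulr_ge0// powR_ge0.
by rewrite mulf_eq0 powR_eq0 p0 andbT -mulf_eq0 => /eqP.
Qed.

(** Writing the normalized family as a power with exponent 1/p, equal to 0 when p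
    is infinite, lets one argument cover finite and infinite exponents. *)
Lemma dnorm_normalize (p : \bar R) a : (1 <= p)%E -> (forall i, 0 <= a i) ->
  0 < dnorm p a ->
  exists u : I -> R, [/\ forall i, 0 <= u i,
    forall i, a i / dnorm p a <= u i `^ fine p^-1 &
    fine p^-1 * \sum_i W * u i <= fine p^-1].
Proof.
case: p => [p||//] p1 a0 ap; last first.
  rewrite invey; exists (fun=> 1); split => [//|i|]; last by rewrite mul0r.
  rewrite powRr0 ler_pdivrMr// mul1r.
  exact: le_bigmax.
rewrite lee_fin in p1; have p0 : 0 < p by apply: lt_le_trans p1.
have -> : fine (p%:E^-1)%E = p^-1 by rewrite inver (negbTE (lt0r_neq0 p0)).
exists (fun i => (a i / dnorm p%:E a) `^ p); split.
- by move=> i; exact: powR_ge0.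
- move=> i; rewrite -powRrM mulfV ?lt0r_neq0// powRr1 ?lexx//.
  by apply: divr_ge0 => //; exact: ltW.
set al := dnorm _ _ in ap *.
have alE : al `^ p = \sum_i W * a i `^ p.
  rewrite /al /dnorm -powRrM mulVf ?lt0r_neq0// powRr1//.
  by apply: sumr_ge0 => i _; rewrite mulr_ge0// powR_ge0.
rewrite (eq_bigr (fun i => W * a i `^ p / al `^ p)); last first.
  move=> i _; rewrite powRM ?invr_ge0 ?(ltW ap)// mulrA.
  by rewrite -powR_inv1 ?(ltW ap)// -powRrM mulN1r powRN.
rewrite -mulr_suml -alE mulfV ?mulr1//.
by rewrite powR_eq0 negb_and (lt0r_neq0 ap).
Qed.

Lemma fine_inv_ge0 (p : \bar R) : (1 <= p)%E -> 0 <= fine p^-1%E.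
Proof.
case: p => [p||//] p1; last by rewrite invey.
rewrite inver; rewrite lee_fin in p1; have p0 : 0 < p by apply: lt_le_trans p1.
by rewrite (negbTE (lt0r_neq0 p0))/= invr_ge0 ltW.
Qed.

Lemma inv_fin_num (p : \bar R) : (1 <= p)%E -> (p^-1)%E = (fine p^-1%E)%:E.
Proof.
case: p => [p||//] p1; last by rewrite invey.
rewrite inver; rewrite lee_fin in p1; have p0 : 0 < p by apply: lt_le_trans p1.
by rewrite (negbTE (lt0r_neq0 p0)).
Qed.

Lemma dnorm_hoelder (p q r : \bar R) (a b c : I -> R) :
  (1 <= p)%E -> (1 <= q)%E -> (1 <= r)%E -> (p^-1 + q^-1 + r^-1 = 1)%E ->
  (forall i, 0 <= a i) -> (forall i, 0 <= b i) -> (forall i, 0 <= c i) ->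
  \sum_i W * (a i * b i * c i) <= dnorm p a * dnorm q b * dnorm r c.
Proof.
move=> p1 q1 r1 pqr a0 b0 c0.
have := dnorm_ge0 p a0; rewrite le_eqVlt => /orP[/eqP/esym ap|ap].
  rewrite ap !mul0r big1// => i _.
  by rewrite mulrA mulrA (dnorm_eq0 p1 a0 ap) !mul0r.
have := dnorm_ge0 q b0; rewrite le_eqVlt => /orP[/eqP/esym bp|bp].
  rewrite bp mulr0 mul0r big1// => i _.
  by rewrite [a i * _]mulrC mulrA mulrA (dnorm_eq0 q1 b0 bp) !mul0r.
have := dnorm_ge0 r c0; rewrite le_eqVlt => /orP[/eqP/esym cp|cp].
  rewrite cp mulr0 big1// => i _.
  by rewrite [_ * c i]mulrC mulrA (dnorm_eq0 r1 c0 cp) !mul0r.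
have [u [u0 ua us]] := dnorm_normalize p1 a0 ap.
have [v [v0 vb vs]] := dnorm_normalize q1 b0 bp.
have [w [w0 wc ws]] := dnorm_normalize r1 c0 cp.
have pqr' : fine p^-1%E + fine q^-1%E + fine r^-1%E = 1.
  move: pqr; rewrite (inv_fin_num p1) (inv_fin_num q1) (inv_fin_num r1).
  by rewrite -!EFinD => -[].
have := fine_inv_ge0 p1; have := fine_inv_ge0 q1; have := fine_inv_ge0 r1.
move: us vs ws ua vb wc pqr'.
set t1 := fine p^-1%E; set t2 := fine q^-1%E; set t3 := fine r^-1%E.
move=> us vs ws ua vb wc pqr' t30 t20 t10.
set al := dnorm p a; set be := dnorm q b; set ga := dnorm r c.
rewrite -[leRHS]mulr1 -ler_pdivrMl ?mulr_gt0//.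
rewrite mulr_sumr.
apply: (@le_trans _ _ (\sum_i W * (t1 * u i + t2 * v i + t3 * w i))).
  apply: ler_sum => i _.
  rewrite mulrCA; apply: ler_wpM2l => //.
  apply: le_trans (weighted_amgm (u0 i) (v0 i) (w0 i) t10 t20 t30 pqr').
  have -> : (al * be * ga)^-1 * (a i * b i * c i) =
      (a i / al) * (b i / be) * (c i / ga).
    by field; rewrite !lt0r_neq0.
  have a1 : 0 <= a i / al by apply: divr_ge0 => //; exact: ltW.
  have b1 : 0 <= b i / be by apply: divr_ge0 => //; exact: ltW.
  have c1 : 0 <= c i / ga by apply: divr_ge0 => //; exact: ltW.
  by apply: ler_pM => //; [exact: mulr_ge0|exact: ler_pM].
rewrite (eq_bigr (fun i => t1 * (W * u i) + t2 * (W * v i) + t3 * (W * w i))); last first.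
  by move=> i _; ring.
rewrite big_split/= big_split/= -!mulr_sumr -pqr'.
rewrite -!mulr_sumr in us vs ws.
by apply: lerD => //; exact: lerD.
Qed.

End discrete_hoelder.

(** * Chords of the interface *)

Section axis_taylor.
Variable R : realType.

Lemma compact_real_bound (T : topologicalType) (f : T -> R^o) (K : set T) :
  compact K -> continuous f -> exists B : R, 0 <= B /\ forall x, K x -> `|f x| <= B.
Proof.
move=> cK cf.
have /ex_strict_bound_gt0[B B0 HB] : bounded_set (f @` K).
  apply: compact_bounded; apply: continuous_compact => //.
  exact: continuous_subspaceT.
by exists B; split; [exact: ltW|move=> x Kx; apply/ltW/HB; exists x].
Qed.

Lemma is_derive_line (V W : normedModType R) (f : V -> W) (x v : V) (s : R) :
  derivable f (x + s *: v) v ->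
  is_derive (s : R^o) (1 : R^o) (fun u : R^o => f (x + u *: v))
    ('D_v f (x + s *: v)).
Proof.
move=> df.
have E : (fun h : R => h^-1 *: (f (x + (h *: (1 : R^o) + s) *: v) - f (x + s *: v))) =
         (fun h : R => h^-1 *: (f (h *: v + (x + s *: v)) - f (x + s *: v))).
  apply/funext => h; congr (_ *: (f _ - _)).
  by rewrite scalerDl addrCA /GRing.scale/= mulr1.
split; last by rewrite /derive /= E.
by rewrite /derivable /= E.
Qed.

Lemma mvt_unordered (g g' : R -> R) (a b : R) :
  (forall s : R, is_derive (s : R^o) (1 : R^o) (g : R^o -> R^o) (g' s)) ->
  exists c, [/\ `|c - a| <= `|b - a| & g b - g a = g' c * (b - a)].
Proof.
move=> dg; have cg (A : set R) : {within A, continuous g}.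
  apply: continuous_subspaceT => x.
  apply: (@differentiable_continuous _ R^o R^o); apply/derivable1_diffP.
  by case: (dg x).
have [ab|ba] := leP a b.
  have [c] := MVT_segment ab (fun x _ => dg x) (cg _).
  rewrite in_itv/= => /andP[ac cb] E; exists c; split => //.
  by rewrite !ger0_norm ?subr_ge0// lerD2r.
have [c] := MVT_segment (ltW ba) (fun x _ => dg x) (cg _).
rewrite in_itv/= => /andP[bc ca] E; exists c; split.
  by rewrite ![`|_ - a|]distrC !ger0_norm ?subr_ge0 ?lerD2l ?lerN2// ltW.
by rewrite -opprB E -mulrN opprB.
Qed.

Lemma axis_mvt n (f : 'rV[R]_n -> R^o) (y z : 'rV[R]_n) (d : R) :
  (forall i x, derivable f x (delta_mx ord0 i)) ->
  (forall l, `|z ord0 l - y ord0 l| <= d) ->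
  exists xi : 'I_n -> 'rV[R]_n,
    (forall i l, `|xi i ord0 l - y ord0 l| <= d) /\
    f z - f y = \sum_i (z ord0 i - y ord0 i) * partial i f (xi i).
Proof.
move=> df zy.
pose p (j : nat) : 'rV[R]_n := \row_l (if (l < j)%N then z ord0 l else y ord0 l).
have p0 : p 0 = y by apply/rowP => l; rewrite mxE.
have pn : p n = z by apply/rowP => l; rewrite mxE ltn_ord.
have step (j : 'I_n) : exists xi : 'rV[R]_n,
    (forall l, `|xi ord0 l - y ord0 l| <= d) /\
    f (p j.+1) - f (p j) = (z ord0 j - y ord0 j) * partial j f xi.
  pose g (s : R) := f (p j + s *: delta_mx ord0 j).
  have dg (s : R) : is_derive (s : R^o) (1 : R^o) (g : R^o -> R^o)
      (partial j f (p j + s *: delta_mx ord0 j)).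
    exact: (is_derive_line (df j _)).
  have [c [c0 E]] := mvt_unordered 0 (z ord0 j - y ord0 j) dg.
  exists (p j + c *: delta_mx ord0 j); split.
    move=> l; rewrite !mxE/=; have [->|lj] := eqVneq l j.
      rewrite ltnn mulr1 addrAC subrr add0r.
      by rewrite !subr0 in c0; exact: le_trans (zy j).
    rewrite mulr0 addr0; case: ifP => _ //.
    by rewrite subrr normr0; apply: le_trans (zy l).
  rewrite !subr0 in E; rewrite [RHS]mulrC -E /g scale0r addr0; congr (f _ - _).
  apply/rowP => l; rewrite !mxE/= ltnS leq_eqVlt.
  have [->|lj] := eqVneq l j; first by rewrite eqxx/= ltnn mulr1 subrKC.
  by rewrite (negbTE (lj : (l != j :> nat))) /= mulr0 addr0.
have [xi xiP] := choice step.
exists xi; split; first by move=> i; case: (xiP i).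
under eq_bigr => i _ do rewrite -(xiP i).2.
rewrite -(big_mkord xpredT (fun i => f (p i.+1) - f (p i))) telescope_sumr//.
by rewrite p0 pn.
Qed.

(** Going from y to z along the coordinate axes, twice, reduces Taylor's estimate
    to the mean value theorem in one variable; only iterated partial derivatives
    enter. *)
Lemma axis_taylor2 n (f : 'rV[R]_n -> R^o) (y z : 'rV[R]_n) (d L : R) :
  (forall i x, derivable f x (delta_mx ord0 i)) ->
  (forall i j x, derivable (partial i f) x (delta_mx ord0 j)) ->
  (forall l, `|z ord0 l - y ord0 l| <= d) ->
  (forall i j (x : 'rV[R]_n), (forall l, `|x ord0 l - y ord0 l| <= d) ->
     `|partial j (partial i f) x| <= L) ->
  `|f z - f y - \sum_i (z ord0 i - y ord0 i) * partial i f y|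
    <= n%:R * n%:R * L * d ^+ 2.
Proof.
move=> df ddf zy HL.
have [xi [xid ->]] := axis_mvt df zy.
rewrite -sumrB (le_trans (ler_norm_sum _ _ _))//.
have -> : n%:R * n%:R * L * d ^+ 2 = \sum_(i < n) d * (\sum_(j < n) d * L).
  have sc (c : R) : \sum_(i < n) c = n%:R * c.
    by rewrite sumr_const card_ord mulr_natl.
  by rewrite !sc; ring.
apply: ler_sum => i _; rewrite -mulrBr normrM; apply: ler_pM => //.
have [eta [etad ->]] := axis_mvt (ddf i) (xid i).
rewrite (le_trans (ler_norm_sum _ _ _))//; apply: ler_sum => j _.
by rewrite normrM; apply: ler_pM => //; exact: HL.
Qed.

End axis_taylor.

Section interface.
Variables (R : realType) (n : nat).
Local Notation Rd := 'rV[R]_n.+1.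

Lemma spacetime_quotient (W : normedModType R) (F : R^o * Rd -> W) t (x w : Rd) :
  (fun h : R => h^-1 *: (F (h *: (0, w) + (t, x)) - F (t, x))) =
  (fun h : R => h^-1 *: (F (t, h *: w + x) - F (t, x))).
Proof.
apply/funext => h; congr (_ *: (F _ - _)).
by congr pair; rewrite /= scaler0 add0r.
Qed.

Lemma spacetime_derivable (W : normedModType R) (F : R^o * Rd -> W) t (x w : Rd) :
  derivable F (t, x) (0, w) -> derivable (fun y => F (t, y)) x w.
Proof. by rewrite /derivable spacetime_quotient. Qed.

Lemma spacetime_derive (W : normedModType R) (F : R^o * Rd -> W) t (x w : Rd) :
  'D_w (fun y => F (t, y)) x = 'D_(0, w) F (t, x).
Proof. by rewrite /derive spacetime_quotient. Qed.

(** A defining function vanishes at both ends of a chord, so that Taylor's formula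
    leaves only second-order terms in the product of the chord with its gradient.
    Compactness of the space-time interface bounds the second derivatives from
    above and the gradient from below, uniformly in time. *)
Lemma chord_normal (S : flow R n) : smooth_flow S 2 ->
  exists2 C : R, 0 < C & forall t (y z : Rd) (s d eps : R),
    0 <= t <= Tend S -> Gam S t y -> Gam S t z ->
    (forall l, `|z ord0 l - y ord0 l| <= d) ->
    (forall l, `|(s *: nrm S t y) ord0 l| <= eps) ->
    `|\sum_l (z ord0 l - y ord0 l) * (s *: nrm S t y) ord0 l| <= C * d ^+ 2 * eps.
Proof.
move=> [[[cO _ _ _] T0 [phi [Cphi Hphi]] _] _].
pose Phi : R^o * Rd -> R^o := spacetime phi.
pose ei i : R^o * Rd := (0, delta_mx ord0 i).
have [cPhi D1] := Cphi.
have dPhi i z : derivable Phi z (ei i) by have [] := D1 (ei i).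
have c1 i : continuous ('D_(ei i) Phi) by have [_ []] := D1 (ei i).
have d2Phi i j z : derivable ('D_(ei i) Phi) z (ei j).
  by have [_ [_ /(_ (ei j)) []]] := D1 (ei i).
have c2 i j : continuous ('D_(ei j) ('D_(ei i) Phi)).
  by have [_ [_ /(_ (ei j)) [_ []]]] := D1 (ei i).
have pE i t x : partial i (phi t : Rd -> R^o) x = 'D_(ei i) Phi (t, x).
  exact: (@spacetime_derive R^o Phi).
have p1 t i x : derivable (phi t : Rd -> R^o) x (delta_mx ord0 i).
  exact: (@spacetime_derivable R^o Phi t x _ (dPhi i (t, x))).
have pE' t i : partial i (phi t : Rd -> R^o) = (fun x => 'D_(ei i) Phi (t, x)).
  by apply/funext => x; exact: pE.
have p2 t i j x : derivable (partial i (phi t : Rd -> R^o)) x (delta_mx ord0 j).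
  by rewrite pE'; exact: (@spacetime_derivable R^o _ t x _ (d2Phi i j (t, x))).
have pE2 t i j x : partial j (partial i (phi t : Rd -> R^o)) x =
    'D_(ei j) ('D_(ei i) Phi) (t, x).
  by rewrite pE' /partial; exact: spacetime_derive.
have [B [B0 HB]] : exists B : R, 0 <= B /\
    forall x, Om S x -> forall l, `|x ord0 l| <= B.
  have H l : exists B : R, 0 <= B /\ forall x, Om S x -> `|x ord0 l| <= B.
    exact: (compact_real_bound cO (@coord_continuous R 1 n.+1 ord0 l)).
  have [B HB] := choice H; exists (\sum_l B l); split.
    by apply: sumr_ge0 => l _; case: (HB l).
  move=> x Ox l; apply: le_trans ((HB l).2 x Ox) _.
  rewrite (bigD1 l)//= lerDl; apply: sumr_ge0 => l' _; by case: (HB l').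
(* Points that are coordinatewise as close to y as z is lie in this cube. *)
pose cube : set Rd := [set v | forall i, v ord0 i \in `[(- (3 * B)), 3 * B]].
have ccube : compact cube.
  apply: (@rV_compact _  _ (fun=> `[(- (3 * B)), 3 * B]%classic)).
  by move=> _; exact: segment_compact.
pose K1 : set (R^o * Rd) := `[0, Tend S]%classic `*` cube.
have cK1 : compact K1.
  by apply: compact_setX => //; exact: segment_compact.
have [L [L0 HL]] : exists L : R, 0 <= L /\ forall i j z, K1 z ->
    `|'D_(ei j) ('D_(ei i) Phi) z| <= L.
  have H (ij : 'I_n.+1 * 'I_n.+1) : exists L : R, 0 <= L /\ forall z, K1 z ->
      `|'D_(ei ij.2) ('D_(ei ij.1) Phi) z| <= L.
    exact: compact_real_bound.
  have [L HL] := choice H; exists (\sum_ij L ij); split.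
    by apply: sumr_ge0 => l _; case: (HL l).
  move=> i j z Kz; apply: le_trans ((HL (i, j)).2 z Kz) _.
  rewrite (bigD1 (i, j))//= lerDl; apply: sumr_ge0 => l' _; by case: (HL l').
pose G (z : R^o * Rd) : R := \sum_i `|'D_(ei i) Phi z|.
have cG : continuous (G : R^o * Rd -> R^o).
  apply: (@continuous_big R^o _ +%R 0 xpredT (@add_continuous _)) => i _ z.
  exact: (continuous_comp (c1 i z) (@norm_continuous R R^o _)).
pose K2 : set (R^o * Rd) := (`[0, Tend S]%classic `*` Om S) `&` (Phi @^-1` [set 0]).
have cK2 : compact K2.
  apply: compact_closedI; first by apply: compact_setX => //; exact: segment_compact.
  apply: ((continuous_closedP Phi).1 cPhi).
  exact: (@closed_eq R 0).
have GamK2 t y : 0 <= t <= Tend S -> Gam S t y -> K2 (t, y).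
  move=> tT Gy; have [_ GE GO _] := Hphi t tT; split.
    split; first by rewrite /= in_itv.
    by apply: interior_subset; apply: GO; right.
  by rewrite GE in Gy.
have [c c0 Hc] : exists2 c : R, 0 < c & forall t y,
    0 <= t <= Tend S -> Gam S t y -> c <= G (t, y).
  have [K20|/nonemptyPn K20] := pselect (K2 !=set0); last first.
    by exists 1 => // t y tT Gy; have := GamK2 _ _ tT Gy; rewrite K20.
  have [[t0 y0] /set_mem K0 Kmin] := compact_EVT_min K20 cK2
    (continuous_subspaceT cG).
  have [[]] := K0; rewrite /= in_itv/= => tT Oy Py.
  have [_ GE _ Hg] := Hphi t0 tT.
  have Gy : Gam S t0 y0 by rewrite GE.
  exists (G (t0, y0)); last first.
    by move=> t y tT' Gy'; apply/Kmin/mem_set/GamK2.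
  have [g0 _] := Hg _ Gy; rewrite lt_def sumr_ge0// andbT.
  apply/negP => /eqP/psumr_eq0P S0; move/eqP : g0; apply.
  apply/rowP => i; rewrite !mxE pE; apply/eqP; rewrite -normr_eq0.
  by apply/eqP/S0.
exists (n.+1%:R * n.+1%:R * (L + 1) * (n.+1%:R / c)).
  by rewrite !mulr_gt0 ?invr_gt0// ltr_wpDl.
move=> t y z s d eps tT Gy Gz zy se.
have [_ GE GO Hg] := Hphi t tT.
have Oy : Om S y by apply: interior_subset; apply: GO; right.
have Oz : Om S z by apply: interior_subset; apply: GO; right.
have d0 : 0 <= d by exact: le_trans (zy ord0).
have eps0 : 0 <= eps by exact: le_trans (se ord0).
(* A chord is no longer than 2 B; beyond that length the bound d could leave the
   cube where the second derivatives are controlled. *)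
pose d' := Num.min d (2 * B).
have zy' l : `|z ord0 l - y ord0 l| <= d'.
  rewrite le_min zy/= (le_trans (ler_normB _ _))//.
  by rewrite mulrDl mul1r lerD// HB.
have d'd : d' <= d by rewrite ge_min lexx.
have d'0 : 0 <= d' by exact: le_trans (zy' ord0).
have := @axis_taylor2 _ _ (phi t) y z d' (L + 1) (p1 t) (p2 t) zy'.
have := Gy; rewrite {1}GE => /= ->; have := Gz; rewrite {1}GE => /= ->.
rewrite subrr sub0r normrN => tay.
have [g0 nE] := Hg y Gy.
set lam := s * (enorm (grad (phi t) y))^-1.
have eE l : (s *: nrm S t y) ord0 l = lam * 'D_(ei l) Phi (t, y).
  by rewrite nE scalerA !mxE pE.
rewrite (eq_bigr (fun l => lam *
  ((z ord0 l - y ord0 l) * 'D_(ei l) Phi (t, y)))); last first.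
  by move=> l _; rewrite eE mulrCA.
rewrite -mulr_sumr normrM.
have lamle : `|lam| <= n.+1%:R / c * eps.
  rewrite mulrAC ler_pdivlMr//.
  apply: (@le_trans _ _ (`|lam| * G (t, y))); first by apply: ler_wpM2l => //; exact: Hc.
  rewrite mulr_sumr mulr_natl -[X in _ *+ X](card_ord n.+1) -sumr_const.
  by apply: ler_sum => l _; rewrite -normrM -eE.
rewrite mulrC (_ : _ * d ^+ 2 * eps =
  (n.+1%:R * n.+1%:R * (L + 1) * d ^+ 2) * (n.+1%:R / c * eps)); last by ring.
apply: ler_pM => //.
apply: (@le_trans _ _ (n.+1%:R * n.+1%:R * (L + 1) * d' ^+ 2)); last first.
  by apply: ler_wpM2l; rewrite ?mulr_ge0 ?addr_ge0// ler_sqr ?nnegrE.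
rewrite (eq_bigr (fun l => (z ord0 l - y ord0 l) * partial l (phi t : Rd -> R^o) y)).
  2: by move=> l _; rewrite pE.
apply: tay => i j x xy; rewrite pE2.
apply: (@le_trans _ _ L); last by rewrite lerDl.
apply: HL; split => /=; first by rewrite in_itv.
move=> l; rewrite in_itv/= -ler_norml.
rewrite -(subrK (y ord0 l) (x ord0 l)) (le_trans (ler_normD _ _))//.
rewrite (_ : 3 * B = 2 * B + B); last by ring.
apply: lerD; last exact: HB.
by rewrite (le_trans (xy l))// ge_min lexx orbT.
Qed.

End interface.

(** * Regularity of shape functions and measure of the simplex *)

Lemma rvE (R : realType) r (t : r.-tuple (measurableTypeR R)) j :
  rv t ord0 j = tnth t j.
Proof. by rewrite mxE. Qed.

Section tame_functions.
Variables (R : realType) (r : nat).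
Local Notation Rr := 'rV[R]_r.
Local Notation mR := (measurableTypeR R).

(** The regularity of shape functions that matters below; polynomials have it,
    and this form is stable under sums and products. *)
Definition tame (K : R) (p : Rr -> R^o) : Prop :=
  [/\ 0 <= K,
      forall x, differentiable p x,
      measurable_fun setT (p \o @rv R r : _ -> R) /\
        forall j, measurable_fun setT (partial j p \o @rv R r : _ -> R),
      forall x, ref_simplex x ->
        `|p x| <= K /\ forall j, `|partial j p x| <= K
    & forall x y d, ref_simplex x -> ref_simplex y -> 0 <= d ->
        (forall j, `|x ord0 j - y ord0 j| <= d) -> `|p x - p y| <= K * d].

Lemma ref_simplex_le1 (x : Rr) j : ref_simplex x -> 0 <= x ord0 j <= 1.
Proof.
move=> [x0 x1]; rewrite x0 (le_trans _ x1)// (bigD1 j)//= lerDl.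
by apply: sumr_ge0.
Qed.

Lemma tame_cst (c : R) : exists K, tame K (fun=> c).
Proof.
have D j : partial j (fun=> c : R^o) = cst 0 :> (Rr -> R^o).
  by apply/funext => x; exact: derive_cst.
exists `|c|; split => //.
- split; first exact: measurable_cst.
  by move=> j; rewrite D; exact: measurable_cst.
- by move=> x _; split => // j; rewrite D normr0.
- by move=> x y d _ _ d0 _; rewrite subrr normr0 mulr_ge0.
Qed.

Lemma tame_coord (i : 'I_r) : exists K, tame K (fun x => x ord0 i).
Proof.
have D j : partial j (fun x : Rr => x ord0 i : R^o) = cst ((i == j)%:R).
  apply/funext => x; rewrite /partial.
  have did : derivable (id : Rr -> Rr) x (delta_mx ord0 j) by exact: derivable_id.
  have := derive_mx did.
  rewrite derive_id => /(congr1 (fun M : 'rV[R]_r => M ord0 i)).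
  by rewrite !mxE eqxx => <-.
exists 1; split => //.
- by move=> x; exact: differentiable_coord.
- split; last by move=> j; rewrite D; exact: measurable_cst.
  have -> : (fun x : Rr => x ord0 i) \o @rv R r =
      (fun t : r.-tuple mR => tnth t i) by apply/funext => t; exact: rvE.
  exact: measurable_tnth.
- move=> x Tx; split; last first.
    by move=> j; rewrite D /cst; case: eqP => _; rewrite ?normr1 ?normr0.
  by have /andP[x0 x1] := ref_simplex_le1 i Tx; rewrite ger0_norm.
- by move=> x y d _ _ d0 xy; rewrite mul1r.
Qed.

Lemma tame_add K1 K2 p q : tame K1 p -> tame K2 q ->
  tame (K1 + K2) (fun x => p x + q x).
Proof.
move=> [K10 dp [mp mp'] bp lp] [K20 dq [mq mq'] bq lq].
have D j : partial j (fun x => p x + q x : R^o) =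
    (fun x => partial j p x + partial j q x).
  apply/funext => x; exact: (deriveD (diff_derivable _) (diff_derivable _)).
split.
- exact: addr_ge0.
- by move=> x; exact: (differentiableD (dp x) (dq x)).
- split; first exact: measurable_funD.
  by move=> j; rewrite D; exact: (measurable_funD (mp' j) (mq' j)).
- move=> x Tx; have [p1 p2] := bp x Tx; have [q1 q2] := bq x Tx.
  split; first by rewrite (le_trans (ler_normD _ _))// lerD.
  by move=> j; rewrite D (le_trans (ler_normD _ _))// lerD.
- move=> x y d Tx Ty d0 xy; rewrite opprD addrACA mulrDl.
  by rewrite (le_trans (ler_normD _ _))// lerD// ?lp// lq.
Qed.

Lemma tame_mul K1 K2 p q : tame K1 p -> tame K2 q ->
  tame (2 * (K1 + 1) * (K2 + 1)) (fun x => p x * q x).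
Proof.
move=> [K10 dp [mp mp'] bp lp] [K20 dq [mq mq'] bq lq].
have D j : partial j (fun x => p x * q x : R^o) =
    (fun x => p x * partial j q x + q x * partial j p x).
  apply/funext => x; exact: (deriveM (diff_derivable _) (diff_derivable _)).
have KK : 2 * (K1 * K2) <= 2 * (K1 + 1) * (K2 + 1).
  by rewrite -mulrA ler_pM2l// ler_pM// lerDl.
have KK0 : 0 <= K1 * K2 by exact: mulr_ge0.
split.
- by rewrite !mulr_ge0 ?addr_ge0.
- by move=> x; exact: (differentiableM (dp x) (dq x)).
- split; first exact: measurable_funM.
  move=> j; rewrite D.
  exact: (measurable_funD (measurable_funM mp (mq' j)) (measurable_funM mq (mp' j))).
- move=> x Tx; have [p1 p2] := bp x Tx; have [q1 q2] := bq x Tx.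
  split.
    apply: (le_trans _ KK); rewrite normrM (@le_trans _ _ (K1 * K2))//.
      exact: ler_pM.
    by rewrite mulr_natl mulr2n lerDl.
  move=> j; rewrite D; apply: (le_trans _ KK).
  rewrite (le_trans (ler_normD _ _))// mulr_natl mulr2n !normrM.
  by apply: lerD; [exact: ler_pM|rewrite mulrC; exact: ler_pM].
- move=> x y d Tx Ty d0 xy.
  have [p1 _] := bp y Ty; have [q1 _] := bq x Tx.
  have -> : p x * q x - p y * q y = (p x - p y) * q x + p y * (q x - q y) by ring.
  apply: (@le_trans _ _ (2 * (K1 * K2) * d)); last exact: ler_wpM2r.
  rewrite (le_trans (ler_normD _ _))// !normrM.
  rewrite (_ : 2 * (K1 * K2) * d = (K1 * d) * K2 + K1 * (K2 * d)); last by ring.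
  by apply: lerD; apply: ler_pM => //; [exact: lp|exact: lq].
Qed.

Lemma tame_prod (I : Type) (s : seq I) (F : I -> Rr -> R^o) :
  (forall i, exists K, tame K (F i)) ->
  exists K, tame K (fun x => \prod_(i <- s) F i x).
Proof.
move=> HF; elim: s => [|i s [K2 IH]].
  have [K HK] := tame_cst 1; exists K.
  by rewrite (_ : (fun x => _) = fun=> 1)//; apply/funext => x; rewrite big_nil.
have [K1 H1] := HF i; exists (2 * (K1 + 1) * (K2 + 1)).
rewrite (_ : (fun x => _) = fun x => F i x * \prod_(i <- s) F i x).
  exact: tame_mul.
by apply/funext => x; rewrite big_cons.
Qed.

Lemma tame_sum (I : Type) (s : seq I) (F : I -> Rr -> R^o) :
  (forall i, exists K, tame K (F i)) ->
  exists K, tame K (fun x => \sum_(i <- s) F i x).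
Proof.
move=> HF; elim: s => [|i s [K2 IH]].
  have [K HK] := tame_cst 0; exists K.
  by rewrite (_ : (fun x => _) = fun=> 0)//; apply/funext => x; rewrite big_nil.
have [K1 H1] := HF i; exists (K1 + K2).
rewrite (_ : (fun x => _) = fun x => F i x + \sum_(i <- s) F i x).
  exact: tame_add.
by apply/funext => x; rewrite big_cons.
Qed.

Lemma tame_bary (j : 'I_r.+1) : exists K, tame K (fun x => bary x j).
Proof.
rewrite /bary; case: unliftP => [i _|_]; first exact: tame_coord.
have [K1 H1] := tame_cst 1; have [K2 H2] := tame_cst (-1).
have [K3 H3] := tame_sum (index_enum 'I_r) tame_coord.
exists (K1 + (2 * (K2 + 1) * (K3 + 1))).
rewrite (_ : (fun x => _) = fun x : Rr => 1 + (-1) * \sum_i x ord0 i).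
  by apply: tame_add => //; exact: tame_mul.
by apply/funext => x; rewrite mulN1r.
Qed.

Lemma tame_mono K1 K2 p : K1 <= K2 -> tame K1 p -> tame K2 p.
Proof.
move=> K12 [K10 dp mp bp lp]; split => //; first exact: le_trans K12.
  move=> x Tx; have [p1 p2] := bp x Tx.
  by split=> [|j]; [exact: le_trans K12|apply: le_trans K12].
move=> x y d Tx Ty d0 xy; apply: le_trans (lp x y d Tx Ty d0 xy) _.
exact: ler_wpM2r.
Qed.

Lemma tame_lagrange (k : nat) : exists2 K : R, 0 <= K &
  forall b : loc_node k r, tame K (Defs.lagrange b).
Proof.
have H (b : loc_node k r) : exists K, tame K (Defs.lagrange b).
  rewrite /Defs.lagrange; apply: tame_prod => j; apply: tame_prod => i.
  have [K1 H1] := tame_cst (k%:R); have [K2 H2] := tame_bary j.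
  have [K3 H3] := tame_cst (- i%:R); have [K4 H4] := tame_cst (i.+1%:R^-1).
  by eexists; apply: tame_mul H4; apply: tame_add H3; exact: tame_mul H1 H2.
have [K HK] := choice H.
have K0 b : 0 <= K b by case: (HK b).
exists (\sum_b K b) => [|b]; first exact: sumr_ge0.
by apply: tame_mono (HK b); rewrite (bigD1 b)//= lerDl sumr_ge0.
Qed.

End tame_functions.

Section boxes.
Variable R : realType.
Local Notation mR := (measurableTypeR R).

Definition box n (a : 'I_n -> R) (d : R) : set (n.-tuple mR) :=
  [set t | forall i, tnth t i \in `[a i, a i + d]].

Lemma measurable_box n (a : 'I_n -> R) d : measurable (@box n a d).
Proof.
rewrite (_ : box a d = \bigcap_(i in [set: 'I_n])
   ((fun t : n.-tuple mR => tnth t i) @^-1` `[a i, a i + d]%classic)).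
  apply: fin_bigcap_measurable => // i _.
  rewrite -[X in measurable X]setTI; apply: measurable_tnth => //.
by apply/seteqP; split => [t H i _|t H i]; [exact: H|exact: (H i I)].
Qed.

Lemma leb_box n (a : 'I_n -> R) d : 0 <= d -> leb R n (box a d) = (d ^+ n)%:E.
Proof.
move=> d0; elim: n a => [|n IH] a.
  rewrite expr0 /leb /= /leb0 diracE (_ : _ \in _)//.
  by apply/mem_set => -[].
rewrite /= /leb_cons /pushforward.
rewrite (_ : @tcons R n @^-1` box a d =
   `[a ord0, a ord0 + d]%classic `*` box (a \o lift ord0) d); last first.
  apply/seteqP; split => -[x t] /=.
    move=> H; split; first by have := H ord0.
    by move=> i; have := H (lift ord0 i); rewrite tnthS.
  move=> [Hx Ht] i; case: (unliftP ord0 i) => [j ->|->]; last exact: Hx.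
  by rewrite tnthS; exact: Ht.
rewrite product_measure1E; [|exact: measurable_itv|exact: measurable_box].
rewrite IH [X in (X * _)%E](_ : _ = d%:E) -?EFinM ?exprS//.
transitivity (lebesgue_measure (`[a ord0, a ord0 + d]%classic : set R)) => //.
rewrite lebesgue_measure_itv/= lte_fin ltrDl.
have [d1|d1] := ltP 0 d; first by rewrite -EFinB addrAC subrr add0r.
by congr EFin; apply/le_anti; rewrite d0 d1.
Qed.

Lemma measurable_simplex n : measurable (@rv R n @^-1` @ref_simplex R n).
Proof.
rewrite (_ : _ @^-1` _ = (\bigcap_(i in [set: 'I_n])
   ((fun t : n.-tuple mR => tnth t i) @^-1` `[0, +oo[%classic)) `&`
   ((fun t : n.-tuple mR => \sum_i tnth t i) @^-1` `]-oo, 1]%classic)).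
  apply: measurableI.
    apply: fin_bigcap_measurable => // i _.
    by rewrite -[X in measurable X]setTI; apply: measurable_tnth.
  rewrite -[X in measurable X]setTI; apply: measurable_sum => //.
  by move=> i; exact: measurable_tnth.
apply/seteqP; split => t.
  move=> [t0 t1]; split.
    by move=> i _; rewrite /= in_itv/= andbT; have := t0 i; rewrite rvE.
  rewrite /= in_itv/=; move: t1; congr (_ <= 1).
  by apply: eq_bigr => i _; rewrite rvE.
move=> [t0 t1]; split.
  by move=> i; rewrite rvE; have := t0 i I; rewrite /= in_itv/= andbT.
rewrite /= in_itv/= in t1; move: t1; congr (_ <= 1).
by apply: eq_bigr => i _; rewrite rvE.
Qed.

Lemma leb_simplex_le1 n : (leb R n (@rv R n @^-1` @ref_simplex R n) <= 1)%E.
Proof.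
have := @leb_box n (fun=> 0) 1 ler01; rewrite expr1n => <-.
apply: le_measure; rewrite ?inE; [exact: measurable_simplex|exact: measurable_box|].
move=> t /= Tt i; have := ref_simplex_le1 i Tt.
by rewrite rvE in_itv/= add0r.
Qed.

(** The homothety of ratio rho centred at x0 maps the simplex into itself, and the
    simplex contains the cube of side 1 / (n + 1) at the origin. *)
Lemma box_near n (x0 : 'rV[R]_n) (rho : R) (t : n.-tuple mR) :
  ref_simplex x0 -> 0 <= rho <= 1 ->
  box (fun i => (1 - rho) * x0 ord0 i) (rho / n.+1%:R) t ->
  ref_simplex (rv t) /\ forall i, `|rv t ord0 i - x0 ord0 i| <= rho.
Proof.
move=> Tx0 /andP[rho0 rho1] Ht; have n0 : (0 : R) < n.+1%:R by [].
have Ht' i : (1 - rho) * x0 ord0 i <= rv t ord0 i <=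
    (1 - rho) * x0 ord0 i + rho / n.+1%:R.
  by have := Ht i; rewrite rvE in_itv.
have [x00 x01] := Tx0.
have rn : rho / n.+1%:R <= rho by rewrite ler_pdivrMr// ler_peMr// ler1n.
split.
  split=> [i|].
    have /andP[+ _] := Ht' i; apply: le_trans.
    by rewrite mulr_ge0// subr_ge0.
  apply: (@le_trans _ _ (\sum_i ((1 - rho) * x0 ord0 i + rho / n.+1%:R))).
    by apply: ler_sum => i _; case/andP: (Ht' i).
  rewrite big_split/= -mulr_sumr sumr_const card_ord -[leRHS](subrK rho 1).
  apply: lerD; first by rewrite ler_piMr// subr_ge0.
  rewrite -[leLHS]mulr_natl mulrCA ler_piMr//.
  by rewrite ler_pdivrMr// mul1r ler_nat.
move=> i; have /andP[t0 t1] := Ht' i; have /andP[xi0 xi1] := ref_simplex_le1 i Tx0.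
have rx0 : 0 <= rho * x0 ord0 i by exact: mulr_ge0.
have rx1 : rho * x0 ord0 i <= rho by rewrite ler_piMr.
rewrite mulrBl mul1r in t0 t1.
have aux (y x p c s : R) : x - p <= y -> y <= x - p + c -> 0 <= p -> p <= s ->
    c <= s -> - s <= y - x <= s by move=> *; apply/andP; split; lra.
by rewrite ler_norml; exact: aux t0 t1 rx0 rx1 rn.
Qed.

Lemma simplex_integrable n (u : 'rV[R]_n -> R) (B : R) :
  measurable_fun setT (u \o @rv R n) ->
  (forall x, ref_simplex x -> `|u x| <= B) ->
  (leb R n).-integrable (@rv R n @^-1` @ref_simplex R n) (EFin \o (u \o @rv R n)).
Proof.
move=> mu uB; apply: measurable_bounded_integrable.
- exact: measurable_simplex.
- by apply: le_lt_trans (@leb_simplex_le1 n) _; rewrite ltry.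
- exact: measurable_funTS.
- exists B; split; first exact: num_real.
  by move=> M BM t Tt; apply: le_trans (uB _ Tt) (ltW BM).
Qed.

Lemma simplex_Rintegral_le n (u : 'rV[R]_n -> R) (B : R) : 0 <= B ->
  measurable_fun setT (u \o @rv R n) ->
  (forall x, ref_simplex x -> `|u x| <= B) ->
  `|\int[leb R n]_(t in @rv R n @^-1` @ref_simplex R n) u (rv t)| <= B.
Proof.
move=> B0 mu uB; have mS := @measurable_simplex n.
have iu := simplex_integrable mu uB.
apply: le_trans (le_normr_Rintegral mS iu) _.
apply: (@le_trans _ _ (\int[leb R n]_(t in @rv R n @^-1` @ref_simplex R n) B)).
  apply: le_Rintegral => //.
  - by have := integrable_norm iu.
  - apply: (@simplex_integrable n (fun=> B) B); first exact: measurable_cst.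
    by move=> x _; rewrite ger0_norm.
  - by move=> t Tt; exact: uB.
rewrite Rintegral_cst// -[leRHS]mulr1; apply: ler_wpM2l => //.
rewrite -lee_fin fineK ?leb_simplex_le1// ge0_fin_numE//.
by apply: le_lt_trans (@leb_simplex_le1 n) _; rewrite ltry.
Qed.

Lemma simplex_integral_ge n (g : 'rV[R]_n -> R) (x0 : 'rV[R]_n) (rho w : R) :
  measurable_fun setT (g \o @rv R n) ->
  (forall x, ref_simplex x -> 0 <= g x) ->
  ref_simplex x0 -> 0 <= rho <= 1 -> 0 <= w ->
  (forall x, ref_simplex x -> (forall i, `|x ord0 i - x0 ord0 i| <= rho) ->
     w <= g x) ->
  ((w * (rho / n.+1%:R) ^+ n)%:E <=
   \int[leb R n]_(t in @rv R n @^-1` @ref_simplex R n) (g (rv t))%:E)%E.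
Proof.
move=> mg g0 Tx0 /[dup] rho01 /andP[rho0 _] w0 wg.
have mS := @measurable_simplex n.
pose Bx := box (fun i => (1 - rho) * x0 ord0 i) (rho / n.+1%:R).
have mB : measurable Bx by exact: measurable_box.
have BS : Bx `<=` @rv R n @^-1` @ref_simplex R n.
  by move=> t /(box_near Tx0 rho01)[].
apply: (@le_trans _ _ (\int[leb R n]_(t in Bx) (g (rv t))%:E)%E); last first.
  apply: ge0_subset_integral => //.
    by apply: measurable_funTS; exact/measurable_EFinP.
  by move=> t Tt; rewrite lee_fin; exact: g0.
rewrite EFinM -(@leb_box n (fun i => (1 - rho) * x0 ord0 i)) ?divr_ge0// -/Bx.
rewrite -(integral_cst (leb R n) mB); apply: ge0_le_integral => //.
- by apply: measurable_funTS; exact/measurable_EFinP.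
- move=> t Bt; rewrite lee_fin; have [] := box_near Tx0 rho01 Bt; exact: wg.
Qed.

End boxes.

(** * Derivatives of finite element functions *)

Section euclidean_norm.
Variables (R : realType) (n : nat).
Implicit Types v : 'rV[R]_n.

Lemma enorm_ge0 v : 0 <= enorm v.
Proof. exact: sqrtr_ge0. Qed.

Lemma enorm_sqr v : enorm v ^+ 2 = \sum_i v ord0 i ^+ 2.
Proof. by rewrite sqr_sqrtr// sumr_ge0// => i _; exact: sqr_ge0. Qed.

Lemma enorm_eq0 v : enorm v = 0 -> v = 0.
Proof. by move=> v0; apply: sum_sqr_eq0; rewrite -enorm_sqr v0 expr0n. Qed.

Lemma enormZ (a : R) v : enorm (a *: v) = `|a| * enorm v.
Proof.
rewrite /enorm -sqrtr_sqr -sqrtrM ?sqr_ge0// mulr_sumr; congr Num.sqrt.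
by apply: eq_bigr => i _; rewrite mxE exprMn.
Qed.

Lemma coord_le_enorm v i : `|v ord0 i| <= enorm v.
Proof.
rewrite -(@ler_pXn2r _ 2) ?nnegrE ?normr_ge0 ?enorm_ge0// enorm_sqr.
rewrite real_normK ?num_real// (bigD1 i)//= lerDl.
by apply: sumr_ge0 => j _; exact: sqr_ge0.
Qed.

End euclidean_norm.

Section fe_calculus.
Variables (R : realType) (nV k r : nat) (c : 'I_r.+1 -> 'I_nV).
Local Notation phi := (Defs.lagrange (R := R) (k := k) (r := r)).
Hypothesis phi_diff : forall (b : loc_node k r) (x : 'rV[R]_r),
  differentiable (phi b : _ -> R^o) x.

Lemma fe_coord m (F : node nV -> 'rV[R]_m) x l :
  fe k c F x ord0 l = fe k c (fun z => F z ord0 l : R^o) x.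
Proof. by rewrite /fe summxE; apply: eq_bigr => b _; rewrite mxE. Qed.

Lemma fe_scalar (f : node nV -> R^o) x :
  fe k c f x = \sum_(b | is_loc_node b) phi b x * f (glob_node c b).
Proof. by []. Qed.

Lemma fe_is_diff (W : normedModType R) (F : node nV -> W) (x v : 'rV[R]_r) :
  differentiable (fe k c F) x /\
  'D_v (fe k c F) x =
    \sum_(b | is_loc_node b) ('D_v (phi b : _ -> R^o) x : R) *: F (glob_node c b).
Proof.
have feE : fe k c F =
    \sum_(b | is_loc_node b) (fun y : 'rV[R]_r => phi b y *: F (glob_node c b)).
  by apply/funext => y; rewrite fct_sumE.
rewrite feE; elim/big_ind2 : _ => [|f df g dg [f1 f2] [g1 g2]|b _].
- split; first exact: differentiable_cst.
  exact: derive_cst.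
- split; first exact: differentiableD.
  by rewrite deriveD ?f2 ?g2//; exact: diff_derivable.
- split; first exact: (differentiableZl _ (phi_diff b x)).
  rewrite deriveE; last exact: (differentiableZl _ (phi_diff b x)).
  by rewrite diffZl// -deriveE.
Qed.

Lemma J_entry m (F : node nV -> 'rV[R]_m) (x : 'rV[R]_r) j l :
  'J (fe k c F) x j l = \sum_(b | is_loc_node b)
    partial (W := R^o) j (phi b) x * F (glob_node c b) ord0 l.
Proof.
have [d D] := fe_is_diff F x (delta_mx ord0 j).
have := deriveEjacobian (delta_mx ord0 j) d.
rewrite D -rowE => /(congr1 (fun M : 'rV[R]_m => M ord0 l)).
rewrite [RHS]mxE => <-; rewrite summxE.
by apply: eq_bigr => b _; rewrite mxE.
Qed.

(** The derivative of [lagrange_unity]. *)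
Lemma sum_partial_lagrange j (x : 'rV[R]_r) :
  \sum_(b : loc_node k r | is_loc_node b) partial (W := R^o) j (phi b) x = 0.
Proof.
have [d D] := fe_is_diff (fun=> 1 : R^o) x (delta_mx ord0 j).
rewrite [RHS](_ : 0 = 'D_(delta_mx ord0 j) (fe k c (fun=> 1 : R^o)) x).
  by rewrite D; apply: eq_bigr => b _; rewrite [_ *: _]mulr1.
rewrite (_ : fe k c _ = cst 1) ?derive_cst//; apply/funext => y.
rewrite fe_scalar -[RHS](lagrange_unity k y).
by apply: eq_bigr => b _; rewrite mulr1.
Qed.

Lemma ref_simplex_segment (x y : 'rV[R]_r) (s : R) : 0 <= s <= 1 ->
  ref_simplex x -> ref_simplex y -> ref_simplex (x + s *: (y - x)).
Proof.
move=> /andP[s0 s1] [x0 x1] [y0 y1].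
have E i : (x + s *: (y - x)) ord0 i = (1 - s) * x ord0 i + s * y ord0 i.
  by rewrite !mxE; ring.
have s1' : 0 <= 1 - s by rewrite subr_ge0.
split=> [i|]; first by rewrite E addr_ge0// mulr_ge0.
under eq_bigr => i _ do rewrite E.
rewrite big_split/= -!mulr_sumr -[leRHS](subrK s 1).
by apply: lerD; rewrite ler_piMr.
Qed.

(** The mean value theorem along the segment from x to y, which stays in the
    simplex and changes each coordinate by at most 1. *)
Lemma fe_lipschitz m (F : node nV -> 'rV[R]_m) (B : R) l (x y : 'rV[R]_r) :
  (forall z j, ref_simplex z -> `|'J (fe k c F) z j l| <= B) ->
  ref_simplex x -> ref_simplex y ->
  `|fe k c F y ord0 l - fe k c F x ord0 l| <= r%:R * B.
Proof.
move=> JB Tx Ty.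
pose f : 'rV[R]_r -> R^o := fe k c (fun z => F z ord0 l : R^o).
pose g (s : R) : R := f (x + s *: (y - x)).
have fdiff z : differentiable f z by case: (fe_is_diff (fun z => F z ord0 l : R^o) z 0).
have dg (s : R) : is_derive (s : R^o) (1 : R^o) (g : R^o -> R^o)
    ('D_(y - x) f (x + s *: (y - x))).
  have df : derivable f (x + s *: (y - x)) (y - x) by exact: diff_derivable.
  exact: (is_derive_line df).
have cg (A : set R) : {within A, continuous g}.
  apply: continuous_subspaceT => s.
  apply: (@differentiable_continuous _ R^o R^o); apply/derivable1_diffP.
  by case: (dg s).
have [s] := MVT_segment ler01 (fun s _ => dg s) (cg _).
rewrite in_itv/= => s01; rewrite subr0 mulr1 /g scale0r addr0 scale1r subrKC.
rewrite !fe_coord => ->; set z := x + _.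
have Tz : ref_simplex z by exact: ref_simplex_segment.
have -> : 'D_(y - x) f z = \sum_j (y - x) ord0 j * 'J (fe k c F) z j l.
  rewrite (fe_is_diff _ z (y - x)).2.
  under [RHS]eq_bigr => j _ do rewrite J_entry mulr_sumr.
  rewrite exchange_big/=; apply: eq_bigr => b _.
  rewrite [_ *: _]mulrC; under eq_bigr => j _ do rewrite mulrA mulrC.
  rewrite -mulr_sumr; congr (_ * _).
  rewrite {1}[y - x]row_sum_delta deriveE// linear_sum/=.
  by apply: eq_bigr => j _; rewrite linearZ/= /partial deriveE.
apply: le_trans (ler_norm_sum _ _ _) _.
rewrite mulr_natl -[X in _ *+ X](card_ord r) -sumr_const; apply: ler_sum => j _.
rewrite normrM -[leRHS]mul1r; apply: ler_pM => //; last exact: JB.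
rewrite !mxE ler_norml.
have := ref_simplex_le1 j Tx; have := ref_simplex_le1 j Ty.
move: (x ord0 j) (y ord0 j) => a b /andP[? ?] /andP[? ?].
by apply/andP; split; lra.
Qed.

End fe_calculus.

(** * Flat facets and norms over the flat mesh *)

Lemma gram_form (R : realType) r n (A : 'M[R]_(r, n)) (v : 'rV[R]_r) :
  (v *m (A *m A^T) *m v^T) ord0 ord0 = enorm (v *m A) ^+ 2.
Proof.
rewrite mulmxA -[_ *m v^T]mulmxA -trmx_mul enorm_sqr mxE.
by apply: eq_bigr => l _; rewrite [X in _ * X]mxE -expr2.
Qed.

Lemma gram_coercive (R : realType) r n (A : 'M[R]_(r, n)) (a : R) : 0 <= a ->
  (forall (v : 'rV[R]_r) j, a * `|v ord0 j| <= enorm (v *m A)) ->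
  coercive (a ^+ 2 / r.+1%:R) (A *m A^T).
Proof.
move=> a0 Ha v; rewrite gram_form mulrAC ler_pdivrMr// mulr_sumr.
apply: (@le_trans _ _ (\sum_(i < r) enorm (v *m A) ^+ 2)); last first.
  rewrite sumr_const card_ord -[leLHS]mulr_natr; apply: ler_wpM2l; first exact: sqr_ge0.
  by rewrite ler_nat.
apply: ler_sum => j _; rewrite -[v ord0 j ^+ 2]real_normK ?num_real// -exprMn.
by rewrite ler_sqr ?nnegrE ?enorm_ge0 ?mulr_ge0.
Qed.

Section flat_cells.
Variables (R : realType) (n nV nE nF : nat) (M : mesh R n nV nE nF).
Local Notation Rd := 'rV[R]_n.+1.

Lemma edges_sum r (c : 'I_r.+1 -> 'I_nV) (v : 'rV[R]_r) :
  v *m edges M c = \sum_i v ord0 i *: (vtx M (c (lift ord0 i)) - vtx M (c ord0)).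
Proof.
rewrite mulmx_sum_row; apply: eq_bigr => i _; congr (_ *: _).
by apply/rowP => l; rewrite !mxE.
Qed.

Lemma flatE r (c : 'I_r.+1 -> 'I_nV) (x : 'rV[R]_r) :
  flat M c x = vtx M (c ord0) + x *m edges M c.
Proof.
rewrite /flat big_ord_recl edges_sum /bary unlift_none scalerBl scale1r.
under [X in _ = _ + X]eq_bigr => i _ do rewrite scalerBr.
rewrite sumrB -scaler_suml addrAC -addrA; congr (_ + (_ - _)).
by apply: eq_bigr => i _; rewrite liftK.
Qed.

(** The change of the barycentric coordinates along v. *)
Definition bary_incr r (v : 'rV[R]_r) (j : 'I_r.+1) : R :=
  if unlift ord0 j is Some i then v ord0 i else - \sum_i v ord0 i.

Lemma mesh_size_ge e i j :
  enorm (vtx M (elt M e i) - vtx M (elt M e j)) <= mesh_size M.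
Proof.
apply: le_trans (le_bigmax _ _ e); apply: le_trans (le_bigmax _ _ i).
exact: (le_bigmax _ (fun j => enorm (vtx M (elt M e i) - vtx M (elt M e j))) j).
Qed.

Lemma mesh_size_ge0 : 0 <= mesh_size M.
Proof. exact: bigmax_ge_id. Qed.

Variable sigma : R.
Hypotheses (sigma0 : 0 < sigma) (conf : conforming M)
  (qu : quasi_uniform M sigma).

Lemma mesh_size_gt0 (e : 'I_nE) : 0 < mesh_size M.
Proof.
have [vinj einj _ _ _] := conf.
apply: lt_le_trans (mesh_size_ge e (lift ord0 ord0) ord0).
rewrite lt_def enorm_ge0 andbT; apply/eqP => /enorm_eq0/eqP.
by rewrite subr_eq0 => /eqP/vinj/einj.
Qed.

(** An element contains a ball of radius h / sigma; barycentric coordinates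
    vary by at most 1 along a radius, which bounds their Lipschitz constant. *)
Lemma elt_coords_le e (v : 'rV[R]_n.+1) j :
  `|bary_incr v j| * mesh_size M <= sigma * enorm (v *m edges M (elt M e)).
Proof.
set lam := bary_incr v j; have [_ _ free _ _] := conf; have h0 := mesh_size_gt0 e.
set y := v *m _; have [/enorm_eq0 y0|yn0] := eqVneq (enorm y) 0.
  have v0 : v = 0 by apply: (row_free_inj (free e)); rewrite mul0mx.
  have -> : lam = 0.
    rewrite /lam /bary_incr v0; case: unliftP => [i _|_]; rewrite ?mxE// big1 ?oppr0// => i _.
    by rewrite mxE.
  by rewrite normr0 mul0r mulr_ge0 ?enorm_ge0 ?ltW.
have yp : 0 < enorm y by rewrite lt_def yn0 enorm_ge0.
(* The point x0 + s y is on the boundary of that ball. *)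
have [x0 Hx0] := qu e; pose s := mesh_size M / (sigma * enorm y).
have sp : 0 < s by rewrite divr_gt0// mulr_gt0.
have [|be Tbe Ebe] := Hx0 x0.
  by rewrite subrr -(scale0r 0) enormZ normr0 mul0r divr_ge0 ?ltW.
have [|be' Tbe' Ebe'] := Hx0 (x0 + s *: y).
  rewrite addrAC subrr add0r enormZ ger0_norm ?(ltW sp)// /s invfM mulrA.
  by rewrite mulfVK.
have sv : s *: v = be' - be.
  apply: (row_free_inj (free e)); rewrite -scalemxAl -/y mulmxBl.
  move: Ebe Ebe'; rewrite !flatE => Ebe Ebe'.
  have -> : s *: y = (x0 + s *: y) - x0 by rewrite addrAC subrr add0r.
  by rewrite -Ebe' -Ebe opprD addrACA subrr add0r.
have bary_le1 (z : 'rV[R]_n.+1) : ref_simplex z -> 0 <= bary z j <= 1.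
  move=> /[dup] Tz /ref_simplex_bary Hz; rewrite Hz/= -[leRHS](sum_bary z).
  by rewrite (bigD1 j)//= lerDl sumr_ge0.
have slam : s * lam = bary be' j - bary be j.
  rewrite /lam /bary_incr /bary; case: unliftP => [i _|_].
    by move: sv => /rowP/(_ i); rewrite !mxE.
  have -> : 1 - \sum_i be' ord0 i - (1 - \sum_i be ord0 i) =
      - (\sum_i be' ord0 i - \sum_i be ord0 i) by ring.
  rewrite -sumrB mulrN mulr_sumr; congr (- _); apply: eq_bigr => i _.
  by move: sv => /rowP/(_ i); rewrite !mxE.
have : `|s * lam| <= 1.
  rewrite slam ler_norml; have := bary_le1 _ Tbe; have := bary_le1 _ Tbe'.
  move: (bary be j) (bary be' j) => a b /andP[? ?] /andP[? ?].
  by apply/andP; split; lra.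
rewrite normrM ger0_norm ?(ltW sp)// /s mulrAC ler_pdivrMr ?mulr_gt0// mul1r.
by rewrite mulrC.
Qed.

Hypothesis ifcs : interface_facets M.

Lemma facet_in_elt i : exists e (pi : 'I_n.+1 -> 'I_n.+2),
  injective pi /\ forall j, ifc M i j = elt M e (pi j).
Proof.
have [cinj _ Hi _] := ifcs; have [e [e' [_ _ E]]] := Hi i.
have H j : exists l, ifc M i j = elt M e l.
  have : ifc M i j \in vset (ifc M i) by apply: imset_f.
  by rewrite E inE => /andP[/imsetP[l _ ->] _]; exists l.
have [pi piE] := choice H; exists e, pi; split => // j j' jj'.
by apply: (cinj i); rewrite !piE jj'.
Qed.

Lemma facet_mesh_size_gt0 (i : 'I_nF) : 0 < mesh_size M.
Proof. by have [e _] := facet_in_elt i; exact: (mesh_size_gt0 e). Qed.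

Lemma facet_edges_le i j l : `|edges M (ifc M i) j l| <= mesh_size M.
Proof.
have [e [pi [_ piE]]] := facet_in_elt i.
have := mesh_size_ge e (pi (lift ord0 j)) (pi ord0); rewrite -!piE; apply: le_trans.
by apply: le_trans (coord_le_enorm _ l); rewrite mxE.
Qed.

(** The barycentric coordinates of a facet are among those of an adjacent
    element. *)
Lemma facet_coords_le i (v : 'rV[R]_n) j :
  `|v ord0 j| * mesh_size M <= sigma * enorm (v *m edges M (ifc M i)).
Proof.
have [e [pi [pinj piE]]] := facet_in_elt i.
pose mu := bary_incr v.
pose lam (m : 'I_n.+2) := \sum_(j | pi j == m) mu j.
have lamE j' : lam (pi j') = mu j'.
  rewrite /lam (big_pred1 j')// => j''; exact: inj_eq.
have smu : \sum_j mu j = 0.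
  rewrite big_ord_recl /mu /bary_incr unlift_none.
  by rewrite [X in _ + X](eq_bigr (fun i => v ord0 i)) ?addNr// => l _; rewrite liftK.
have slam : \sum_m lam m = 0.
  rewrite -[RHS]smu /lam (exchange_big_dep xpredT)//=; apply: eq_bigr => j' _.
  by rewrite (big_pred1 (pi j'))// => m; rewrite eq_sym.
pose w : 'rV[R]_n.+1 := \row_m lam (lift ord0 m).
have lam0 : lam ord0 = - \sum_m w ord0 m.
  move: slam; rewrite big_ord_recl => /eqP; rewrite addr_eq0 => /eqP ->.
  by congr (- _); apply: eq_bigr => m _; rewrite mxE.
have muV : v *m edges M (ifc M i) = \sum_j mu j *: vtx M (ifc M i j).
  rewrite edges_sum big_ord_recl /mu /bary_incr unlift_none.
  under eq_bigr => l _ do rewrite scalerBr.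
  rewrite sumrB -scaler_suml addrC scaleNr; congr (_ + _).
  by apply: eq_bigr => l _; rewrite liftK.
have lamV : w *m edges M (elt M e) = \sum_m lam m *: vtx M (elt M e m).
  rewrite edges_sum [RHS]big_ord_recl lam0.
  under eq_bigr => l _ do rewrite scalerBr.
  rewrite sumrB -scaler_suml addrC scaleNr; congr (_ + _).
  by apply: eq_bigr => l _; rewrite mxE.
have E : v *m edges M (ifc M i) = w *m edges M (elt M e).
  rewrite muV lamV /lam; under [RHS]eq_bigr => m _ do rewrite scaler_suml.
  rewrite (exchange_big_dep xpredT)//=; apply: eq_bigr => j' _.
  by rewrite (big_pred1 (pi j')) ?piE// => m; rewrite eq_sym.
rewrite E; have := elt_coords_le e w (pi (lift ord0 j)).
have <- : lam (pi (lift ord0 j)) = v ord0 j by rewrite lamE /mu /bary_incr liftK.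
rewrite /bary_incr; case: (unliftP ord0 (pi (lift ord0 j))) => [m ->|->]; first by rewrite mxE.
by rewrite lam0.
Qed.

Lemma facet_gram_unit i :
  edges M (ifc M i) *m (edges M (ifc M i))^T \in unitmx.
Proof.
have h0 := facet_mesh_size_gt0 i.
apply: (@coercive_unitmx _ _ ((mesh_size M / sigma) ^+ 2 / n.+1%:R)).
  by rewrite divr_gt0// exprn_gt0// divr_gt0.
apply: gram_coercive => [|v j]; first by rewrite divr_ge0// ltW.
by rewrite mulrAC ler_pdivrMr// mulrC [_ * sigma]mulrC; exact: facet_coords_le.
Qed.

End flat_cells.

Section flat_derivatives.
Variables (R : realType) (n nV nE nF k r : nat) (M : mesh R n nV nE nF).
Variable c : 'I_r.+1 -> 'I_nV.
Hypothesis phi_diff : forall (b : loc_node k r) (x : 'rV[R]_r),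
  differentiable (Defs.lagrange b : _ -> R^o) x.
Hypothesis gram : edges M c *m (edges M c)^T \in unitmx.

Lemma ref_coord_flat (x : 'rV[R]_r) : ref_coord M c (flat M c x) = x.
Proof.
rewrite /ref_coord flatE addrAC subrr add0r -!mulmxA [edges M c *m _]mulmxA.
by rewrite mulmxV// mulmx1.
Qed.

(** The edges are of length at most h: this formula turns bounds on derivatives
    over the flat mesh into bounds of order h on the Jacobian. *)
Lemma J_flat m (F : node nV -> 'rV[R]_m) (x : 'rV[R]_r) j l :
  'J (fe k c F) x j l =
  \sum_i edges M c j i * partial i (fe_flat k M c F) (flat M c x) ord0 l.
Proof.
pose L := (edges M c)^T *m invmx (edges M c *m (edges M c)^T).
have EL : edges M c *m L = 1%:M by rewrite /L mulmxA mulmxV.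
have [d _] := fe_is_diff c phi_diff F x 0.
have pE i : partial i (fe_flat k M c F) (flat M c x) =
    delta_mx ord0 i *m L *m 'J (fe k c F) x.
  rewrite -(deriveEjacobian _ d).
  have E : (fun h : R => h^-1 *: (fe_flat k M c F (h *: delta_mx ord0 i + flat M c x) -
        fe_flat k M c F (flat M c x))) =
      (fun h : R => h^-1 *: (fe k c F (h *: (delta_mx ord0 i *m L) + x) - fe k c F x)).
    apply/funext => h; congr (_ *: _).
    rewrite /fe_flat ref_coord_flat; congr (fe k c F _ - _).
    rewrite {1}/ref_coord -[in LHS]addrA mulmxDl mulmxDl.
    rewrite -/(ref_coord M c (flat M c x)) ref_coord_flat; congr (_ + _).
    by rewrite /L -!scalemxAl mulmxA.
  by rewrite /partial /derive /= E.
transitivity ((row j (edges M c) *m L *m 'J (fe k c F) x) ord0 l).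
  by rewrite -row_mul EL -row_mul mul1mx [RHS]mxE.
rewrite {1}[row j _]row_sum_delta !mulmx_suml summxE.
by apply: eq_bigr => i _; rewrite pE -!scalemxAl !mxE.
Qed.

Lemma partial_le_tensor m (f : 'rV[R]_n.+1 -> 'rV[R]_m) y i l :
  `|partial i f y ord0 l| <= tensor_norm 1 f y.
Proof.
apply: (@le_trans _ _ (enorm (partial i f y))); first exact: coord_le_enorm.
rewrite -[leLHS]ger0_norm ?enorm_ge0// -sqrtr_sqr ler_wsqrtr//.
have -> : partial i f y = partials [tuple i] f y by [].
rewrite (bigD1 [tuple i])//= lerDl; apply: sumr_ge0 => s _; exact: sqr_ge0.
Qed.

Lemma J_le m (F : node nV -> 'rV[R]_m) (x : 'rV[R]_r) j l (h B : R) :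
  (forall j l, `|edges M c j l| <= h) ->
  tensor_norm 1 (fe_flat k M c F) (flat M c x) <= B ->
  `|'J (fe k c F) x j l| <= n.+1%:R * (h * B).
Proof.
move=> eh TB; rewrite J_flat; apply: le_trans (ler_norm_sum _ _ _) _.
rewrite mulr_natl -[X in _ *+ X](card_ord n.+1) -sumr_const; apply: ler_sum => i _.
rewrite normrM; apply: ler_pM => //.
by apply: le_trans TB; exact: partial_le_tensor.
Qed.

End flat_derivatives.

Section norms_over_cells.
Variables (R : realType) (n nV nE nF k r : nat) (M : mesh R n nV nE nF).
Variables (I : finType) (c : I -> 'I_r.+1 -> 'I_nV).

Lemma bigmaxe_ge0 (J : finType) (N : J -> \bar R) :
  (0 <= \big[maxe/0%E]_l N l)%E.
Proof. exact: bigmax_ge_id. Qed.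

Lemma fe_Wnorm_ge0 m s q (F : node nV -> 'rV[R]_m) : (0 <= fe_Wnorm k M c s q F)%E.
Proof.
by rewrite /fe_Wnorm; case: q => [q||]; rewrite ?poweR_ge0 ?bigmaxe_ge0.
Qed.

Lemma fe_Wnorm_tensor m s (F : node nV -> 'rV[R]_m) (B : R) i x :
  (1 <= s)%N -> (fe_Wnorm k M c s +oo F <= B%:E)%E -> ref_simplex x ->
  tensor_norm 1 (fe_flat k M (c i) F) (flat M (c i) x) <= B.
Proof.
move=> s1 WB Tx; rewrite -lee_fin; apply: le_trans WB.
have s1' : (1 < s.+1)%N by [].
apply: le_trans (le_bigmax _ _ (Ordinal s1')) => /=.
rewrite le_max; apply/orP; right.
have -> : tensor_norm 1 (fe_flat k M (c i) F) (flat M (c i) x) =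
   `|tensor_norm 1 (fe_flat k M (c i) F) (flat M (c i) x)|.
  by rewrite ger0_norm// sqrtr_ge0.
by apply: ereal_sup_ubound; exists (i, x).
Qed.

Lemma inv_W1norm_ge0 (i : I) F : (0 <= inv_W1norm k M c F)%E.
Proof.
rewrite /inv_W1norm; case: asboolP => _ //.
rewrite le_max; apply/orP; left.
apply: (@le_trans _ _ (enorm (flat M (c i) 0))%:E); first by rewrite lee_fin enorm_ge0.
apply: ereal_sup_ubound; exists (i, 0) => //; split => [l|]; first by rewrite mxE.
by rewrite big1// => l _; rewrite mxE.
Qed.

Lemma inv_grad_bound F (B : R) i x (v : 'rV[R]_r) :
  (inv_W1norm k M c F <= B%:E)%E -> ref_simplex x ->
  enorm (v *m edges M (c i)) <= (B + 1) * enorm (v *m 'J (fe k (c i) F) x).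
Proof.
rewrite /inv_W1norm; case: asboolP => // _ WB Tx.
(* The infimum that defines the norm of the inverse need not be attained. *)
have : (inv_grad_norm k M c i F x < (B + 1)%:E)%E.
  apply: (@le_lt_trans _ _ B%:E); last by rewrite lte_fin ltrDl.
  apply: le_trans WB; rewrite le_max; apply/orP; right.
  by apply: ereal_sup_ubound; exists (i, x).
move=> /ereal_inf_lt[_ [L [L0 HL] <-]]; rewrite lte_fin => LB.
apply: le_trans (HL v) _; apply: ler_wpM2r; [exact: enorm_ge0|exact: ltW].
Qed.

End norms_over_cells.

(** * Perturbation of the volume element of a facet *)

Section volume_elements.
Variables (R : realType) (n m : nat).
Implicit Types A B : 'M[R]_(n, m).

Definition gram_vol A : R := Num.sqrt (\det (A *m A^T)).

Lemma gram_vol_scale (h : R) A : 0 < h ->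
  gram_vol A = h ^+ n * gram_vol (h^-1 *: A).
Proof.
move=> h0; rewrite /gram_vol.
have {1}-> : A *m A^T = (h ^+ 2) *: ((h^-1 *: A) *m (h^-1 *: A)^T).
  rewrite linearZ/= -scalemxAl -scalemxAr !scalerA.
  by rewrite (_ : _ * _ = 1) ?scale1r//; field; exact: lt0r_neq0.
rewrite detZ sqrtrM; last by rewrite exprn_ge0// sqr_ge0.
by rewrite -exprM mulnC exprM sqrtr_sqr ger0_norm// exprn_ge0// ltW.
Qed.

Lemma gram_vol_ge A (b : R) : 0 < b ->
  (forall (v : 'rV[R]_n) j, b * `|v ord0 j| <= enorm (v *m A)) ->
  (b ^+ 2 / n.+1%:R) ^+ n / n`!%:R <= \det (A *m A^T).
Proof.
move=> b0 Hb; apply: coercive_det_ge; first by rewrite divr_gt0// exprn_gt0.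
by apply: gram_coercive => //; exact: ltW.
Qed.

Lemma gram_entry_le A (a : R) i j : (forall i j, `|A i j| <= a) ->
  `|(A *m A^T) i j| <= m%:R * a ^+ 2.
Proof.
move=> Aa; rewrite mxE; apply: le_trans (ler_norm_sum _ _ _) _.
rewrite mulr_natl -[X in _ *+ X](card_ord m) -sumr_const; apply: ler_sum => l _.
by rewrite [X in _ * X]mxE normrM expr2; apply: ler_pM.
Qed.

(** B enters the Gram matrix of A + B through A *m B^T and B *m B^T only, so that
    the volume changes by the size d of these products, which can be much smaller
    than the size of B when the rows of B are almost normal to those of A. *)
Lemma gram_vol_diff A B (a b d : R) : 1 <= a -> 0 < b ->
  (forall i j, `|A i j| <= a) -> (forall i j, `|B i j| <= a) ->
  (forall (v : 'rV[R]_n) j, b * `|v ord0 j| <= enorm (v *m A)) ->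
  (forall i j, `|(A *m B^T) i j| <= d) -> (forall i j, `|(B *m B^T) i j| <= d) ->
  `|gram_vol (A + B) - gram_vol A| <=
    n`!%:R * (n%:R * (m.+1%:R * (2 * a) ^+ 2) ^+ n * (3 * d)) /
    Num.sqrt ((b ^+ 2 / n.+1%:R) ^+ n / n`!%:R).
Proof.
move=> a1 b0 Aa Ba Ab ABd BBd.
have a0 : 0 <= a by exact: le_trans a1.
have a2 : 1 <= (2 * a) ^+ 2 by rewrite expr_ge1//; lra.
have dA := gram_vol_ge b0 Ab.
set delta := (b ^+ 2 / n.+1%:R) ^+ n / n`!%:R in dA *.
have delta0 : 0 < delta.
  by rewrite divr_gt0 ?ltr0n ?fact_gt0// exprn_gt0// divr_gt0// exprn_gt0.
rewrite ler_pdivlMr ?sqrtr_gt0//.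
apply: (@le_trans _ _ (`|gram_vol (A + B) - gram_vol A| * gram_vol A)).
  by apply: ler_wpM2l => //; exact: ler_wsqrtr.
apply: le_trans (sqrt_diff_le _ (lt_le_trans delta0 dA)) _.
have mm (x y : R) : 0 <= y -> x <= y -> m%:R * x <= m.+1%:R * y.
  move=> y0 xy; apply: (@le_trans _ _ (m%:R * y)); first exact: ler_wpM2l.
  by apply: ler_wpM2r => //; rewrite ler_nat.
have a20 : 0 <= (2 * a) ^+ 2 by exact: sqr_ge0.
apply: det_lipschitz.
- by rewrite -[leLHS]mulr1 ler_pM// ler1n.
- move=> i j; apply: (@le_trans _ _ (m%:R * (2 * a) ^+ 2)); last exact: mm.
  apply: gram_entry_le => i' j'; rewrite mxE (le_trans (ler_normD _ _))//.
  by rewrite mulr_natl mulr2n lerD.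
- move=> i j; apply: (@le_trans _ _ (m%:R * a ^+ 2)); first exact: gram_entry_le.
  by apply: mm => //; rewrite ler_sqr ?nnegrE ?mulr_ge0//; lra.
- move=> i j.
  have -> : (A + B) *m (A + B)^T = A *m A^T + (A *m B^T + (A *m B^T)^T + B *m B^T).
    by rewrite linearD/= mulmxDl !mulmxDr trmx_mul trmxK !addrA.
  have mxD (X Y : 'M[R]_n) : (X + Y) i j = X i j + Y i j by rewrite mxE.
  rewrite !mxD addrAC subrr add0r (_ : 3 * d = d + d + d); last by ring.
  apply: le_trans (ler_normD _ _) _; apply: lerD => //.
  apply: le_trans (ler_normD _ _) _; apply: lerD => //.
  by rewrite mxE.
Qed.

End volume_elements.

Section cell_estimate.
Variables (R : realType) (n k nV : nat).
Local Notation Rd := 'rV[R]_n.+1.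
Local Notation phi := (Defs.lagrange (R := R) (k := k) (r := n)).
Local Notation mR := (measurableTypeR R).
Hypothesis k0 : (0 < k)%N.
Variable K : R.
Hypothesis phiK : forall b : loc_node k n, tame K (phi b).
Variable c : 'I_n.+1 -> 'I_nV.

Let phi_diff (b : loc_node k n) (x : 'rV[R]_n) : differentiable (phi b : _ -> R^o) x.
Proof. by case: (phiK b). Qed.

Let K0 : 0 <= K.
Proof. by case: (phiK [ffun=> ord0]). Qed.

Definition nloc : R := #|{: loc_node k n}|%:R.

Lemma nloc_ge0 : 0 <= nloc. Proof. exact: ler0n. Qed.

Lemma loc_sum_le (u : loc_node k n -> R) (B : R) : 0 <= B ->
  (forall b, is_loc_node b -> `|u b| <= B) ->
  `|\sum_(b | is_loc_node b) u b| <= nloc * B.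
Proof.
move=> B0 uB; apply: le_trans (ler_norm_sum _ _ _) _.
rewrite /nloc mulr_natl -sumr_const [leRHS](bigID (@is_loc_node k n))/= -[leLHS]addr0.
by apply: lerD; [apply: ler_sum => b; exact: uB|exact: sumr_ge0].
Qed.

Lemma fe_loc_pt (W : normedModType R) (F : node nV -> W) (b : loc_node k n) :
  is_loc_node b -> fe k c F (loc_pt R b) = F (glob_node c b).
Proof.
move=> bk; rewrite /fe (bigD1 b)//= big1.
  by rewrite lagrange_loc_pt// eqxx scale1r addr0.
by move=> b' /andP[b'k b'b]; rewrite lagrange_loc_pt// (negbTE b'b) scale0r.
Qed.

Lemma J_add (F G : node nV -> Rd) (x : 'rV[R]_n) :
  'J (fe k c (fun z => F z + G z)) x = 'J (fe k c F) x + 'J (fe k c G) x.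
Proof.
have mxD p q (X Y : 'M[R]_(p, q)) j l : (X + Y) j l = X j l + Y j l by rewrite mxE.
apply/matrixP => j l; rewrite mxD.
apply: etrans (J_entry c phi_diff _ x j l) _.
apply: etrans (esym (congr2 +%R (J_entry c phi_diff F x j l)
  (J_entry c phi_diff G x j l))).
by rewrite -big_split/=; apply: eq_bigr => b _; rewrite mxD mulrDr.
Qed.

Section volume.
Variables (Q e : node nV -> Rd) (h a b Cs eps : R).
Hypotheses (h0 : 0 < h) (h1 : h <= 1) (a1 : 1 <= a) (b0 : 0 < b) (Cs0 : 0 <= Cs)
  (eps0 : 0 <= eps).
Hypothesis JQ : forall x j l, ref_simplex x -> `|'J (fe k c Q) x j l| <= a * h.
Hypothesis Je : forall x j l, ref_simplex x -> `|'J (fe k c e) x j l| <= a * h ^+ 2.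
Hypothesis JQb : forall x (v : 'rV[R]_n) j, ref_simplex x ->
  b * h * `|v ord0 j| <= enorm (v *m 'J (fe k c Q) x).
Hypothesis e_eps : forall (i : loc_node k n) l, is_loc_node i ->
  `|e (glob_node c i) ord0 l| <= eps.
Hypothesis chord : forall (i j : loc_node k n) d, is_loc_node i -> is_loc_node j ->
  (forall l, `|Q (glob_node c i) ord0 l - Q (glob_node c j) ord0 l| <= d) ->
  `|\sum_l (Q (glob_node c i) ord0 l - Q (glob_node c j) ord0 l) *
     e (glob_node c j) ord0 l| <= Cs * d ^+ 2 * eps.

Definition cross_const : R :=
  (nloc * K) ^+ 2 * (Cs * (n%:R * a) ^+ 2) + n.+1%:R * a * (nloc * K).

Lemma Je_eps x j l : ref_simplex x -> `|'J (fe k c e) x j l| <= nloc * (K * eps).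
Proof.
move=> Tx; rewrite J_entry//; apply: loc_sum_le => [|i ik]; first exact: mulr_ge0.
rewrite normrM; apply: ler_pM => //; last exact: e_eps.
by have [_ _ _ /(_ x Tx) [_ /(_ j)]] := phiK i.
Qed.

(** The tangential derivatives of the parametrization are combinations of
    chords between nodes, because the shape functions sum to 1.  Chords being
    almost orthogonal to the nodal values of e, this contraction is one order
    in h better than the product of the norms of both factors. *)
Lemma cross_le x i j : ref_simplex x ->
  `|('J (fe k c Q) x *m ('J (fe k c e) x)^T) i j| <= h ^+ 2 * (cross_const * eps).
Proof.
move=> Tx; rewrite mxE.
pose dphi i b : R := partial (W := R^o) i (phi b) x.
have dK i' b' : `|dphi i' b'| <= K.
  by have [_ _ _ /(_ x Tx) [_ /(_ i')]] := phiK b'.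
have JQE (p : loc_node k n) l : 'J (fe k c Q) x i l = \sum_(q | is_loc_node q)
    dphi i q * (Q (glob_node c q) ord0 l - Q (glob_node c p) ord0 l).
  apply: etrans (J_entry c phi_diff Q x i l) _.
  under [RHS]eq_bigr => q _ do rewrite mulrBr.
  rewrite sumrB -mulr_suml (_ : \sum_(q | _) dphi i q = 0) ?mul0r ?subr0//.
  exact: (sum_partial_lagrange c).
have JeE l : 'J (fe k c e) x j l = \sum_(p | is_loc_node p)
    dphi j p * e (glob_node c p) ord0 l := J_entry c phi_diff e x j l.
have -> : \sum_l 'J (fe k c Q) x i l * ('J (fe k c e) x)^T l j =
  \sum_(p | is_loc_node p) \sum_(q | is_loc_node q) (dphi j p * dphi i q *
    \sum_l (Q (glob_node c q) ord0 l - Q (glob_node c p) ord0 l) *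
       e (glob_node c p) ord0 l).
  move: ('J (fe k c Q) x) ('J (fe k c e) x) JQE JeE => A B AE BE.
  transitivity (\sum_l \sum_(p | is_loc_node p) \sum_(q | is_loc_node q)
      dphi i q * (Q (glob_node c q) ord0 l - Q (glob_node c p) ord0 l) *
      (dphi j p * e (glob_node c p) ord0 l)).
    apply: eq_bigr => l _; rewrite [X in _ * X]mxE BE mulr_sumr.
    by apply: eq_bigr => p _; rewrite (AE p) mulr_suml.
  rewrite exchange_big/=; apply: eq_bigr => p _.
  rewrite exchange_big/=; apply: eq_bigr => q _.
  by rewrite mulr_sumr; apply: eq_bigr => l _; ring.
have na0 : 0 <= a by exact: le_trans a1.
apply: (@le_trans _ _ (nloc * (nloc * (K * K * (Cs * (n%:R * (a * h)) ^+ 2 * eps))))).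
  have X0 : 0 <= K * K * (Cs * (n%:R * (a * h)) ^+ 2 * eps).
    by apply: mulr_ge0; apply: mulr_ge0 => //; apply: mulr_ge0 => //; exact: sqr_ge0.
  apply: loc_sum_le => [|p pk]; first by rewrite mulr_ge0 ?nloc_ge0.
  apply: loc_sum_le => // q qk; rewrite !normrM; apply: ler_pM; rewrite ?mulr_ge0//.
    exact: ler_pM.
  apply: chord => // l; rewrite -!fe_loc_pt//.
  apply: (fe_lipschitz phi_diff) => [z j' Tz||]; first exact: JQ.
    exact: loc_pt_simplex.
  exact: loc_pt_simplex.
rewrite (_ : nloc * _ = h ^+ 2 * ((nloc * K) ^+ 2 * (Cs * (n%:R * a) ^+ 2) * eps)); last by ring.
apply: ler_wpM2l; first exact: sqr_ge0.
apply: ler_wpM2r => //; rewrite /cross_const lerDl.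
by rewrite !mulr_ge0 ?nloc_ge0.
Qed.

(** One factor is bounded by its a priori bound of order h^2, the other by the
    nodal values. *)
Lemma square_le x i j : ref_simplex x ->
  `|('J (fe k c e) x *m ('J (fe k c e) x)^T) i j| <= h ^+ 2 * (cross_const * eps).
Proof.
move=> Tx; rewrite mxE; have na0 : 0 <= a by exact: le_trans a1.
apply: (@le_trans _ _ (\sum_(l < n.+1) a * h ^+ 2 * (nloc * (K * eps)))).
  apply: le_trans (ler_norm_sum _ _ _) _; apply: ler_sum => l _.
  rewrite [X in _ * X]mxE normrM; apply: ler_pM => //; [exact: Je|exact: Je_eps].
rewrite sumr_const card_ord -mulr_natl.
rewrite (_ : _ * _ = h ^+ 2 * (n.+1%:R * a * (nloc * K) * eps)); last by ring.
apply: ler_wpM2l; first exact: sqr_ge0.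
apply: ler_wpM2r => //; rewrite /cross_const lerDr.
apply: mulr_ge0; first exact: sqr_ge0.
by apply: mulr_ge0 => //; exact: sqr_ge0.
Qed.

Definition vol_const : R :=
  n`!%:R * (n%:R * (n.+2%:R * (2 * a) ^+ 2) ^+ n * (3 * cross_const)) /
    Num.sqrt ((b ^+ 2 / n.+1%:R) ^+ n / n`!%:R).

Let scaled_JQb x (v : 'rV[R]_n) j : ref_simplex x ->
  b * `|v ord0 j| <= enorm (v *m (h^-1 *: 'J (fe k c Q) x)).
Proof.
move=> Tx; have hi : 0 <= h^-1 by rewrite invr_ge0 ltW.
rewrite -scalemxAr enormZ (ger0_norm hi) [leRHS]mulrC ler_pdivlMr// mulrAC.
exact: JQb.
Qed.

Lemma vol_elt_gram (F : node nV -> Rd) x :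
  vol_elt k c F x = h ^+ n * gram_vol (h^-1 *: 'J (fe k c F) x).
Proof. by rewrite -gram_vol_scale. Qed.

(** Divided by h, the Jacobians of Q are bounded above and below, and the products
    of [cross_le] and [square_le] are of the size of the nodal values of e. *)
Lemma vol_elt_diff x : ref_simplex x ->
  `|vol_elt k c (fun z => Q z + e z) x - vol_elt k c Q x| <=
    h ^+ n * (vol_const * eps).
Proof.
move=> Tx; rewrite !vol_elt_gram J_add scalerDr -mulrBr normrM.
rewrite ger0_norm ?exprn_ge0 ?(ltW h0)//; apply: ler_wpM2l.
  by rewrite exprn_ge0// ltW.
have hi : 0 <= h^-1 by rewrite invr_ge0 ltW.
have scale (A B : 'M[R]_(n, n.+1)) i j :
    (forall i j, `|(A *m B^T) i j| <= h ^+ 2 * (cross_const * eps)) ->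
    `|((h^-1 *: A) *m (h^-1 *: B)^T) i j| <= cross_const * eps.
  move=> H; rewrite linearZ/= -scalemxAl -scalemxAr scalerA mxE normrM.
  rewrite ger0_norm ?mulr_ge0// -invfM -expr2 ler_pdivrMl ?exprn_gt0//.
have := @gram_vol_diff R n n.+1 (h^-1 *: 'J (fe k c Q) x) (h^-1 *: 'J (fe k c e) x)
  a b (cross_const * eps) a1 b0.
rewrite /vol_const (_ : _ / _ * eps = n`!%:R * (n%:R * (n.+2%:R * (2 * a) ^+ 2) ^+ n *
   (3 * (cross_const * eps))) / Num.sqrt ((b ^+ 2 / n.+1%:R) ^+ n / n`!%:R)); last by ring.
apply.
- move=> i j; rewrite mxE normrM ger0_norm// ler_pdivrMl// mulrC; exact: JQ.
- move=> i j; rewrite mxE normrM ger0_norm// ler_pdivrMl//.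
  apply: le_trans (Je i j Tx) _; rewrite mulrC ler_wpM2r ?(le_trans _ a1)//.
  by rewrite expr2 ler_piMl// ltW.
- by move=> v j; exact: scaled_JQb.
- by move=> i j; apply: scale => i' j'; exact: cross_le.
- by move=> i j; apply: scale => i' j'; exact: square_le.
Qed.

Lemma vol_elt_ge x : ref_simplex x ->
  h ^+ n * Num.sqrt ((b ^+ 2 / n.+1%:R) ^+ n / n`!%:R) <= vol_elt k c Q x.
Proof.
move=> Tx; rewrite vol_elt_gram; apply: ler_wpM2l; first by rewrite exprn_ge0// ltW.
apply: ler_wsqrtr; apply: gram_vol_ge => // v j; exact: scaled_JQb.
Qed.

Lemma vol_elt_bounded (F : node nV -> Rd) (B : R) x :
  (forall j l, `|'J (fe k c F) x j l| <= B) ->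
  `|vol_elt k c F x| <= Num.sqrt (n`!%:R * (n.+1%:R * B ^+ 2) ^+ n).
Proof.
move=> FB; rewrite ger0_norm ?sqrtr_ge0//; apply: ler_wsqrtr.
apply: le_trans (ler_norm _) _; apply: det_le => i j; exact: gram_entry_le.
Qed.

End volume.

Lemma measurable_loc_sum (u : loc_node k n -> n.-tuple mR -> R) :
  (forall b, measurable_fun setT (u b)) ->
  measurable_fun setT (fun t => \sum_(b | is_loc_node b) u b t).
Proof.
move=> mu; rewrite (_ : (fun t => _) =
    fun t => \sum_b (if is_loc_node b then u b t else 0)); last first.
  by apply/funext => t; rewrite big_mkcond.
apply: (@measurable_sum _ _ R setT _ _
  (fun b t => if is_loc_node b then u b t else 0)) => b.
by case: (is_loc_node b); [exact: mu|exact: measurable_cst].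
Qed.

Lemma measurable_fe (f : node nV -> R^o) :
  measurable_fun setT (fe k c f \o @rv R n : _ -> R).
Proof.
apply: (@measurable_loc_sum (fun b t => phi b (rv t) * f (glob_node c b))) => b.
apply: measurable_funM; last exact: measurable_cst.
by have [_ _ [mb _]] := phiK b.
Qed.

Lemma measurable_vol_elt (F : node nV -> Rd) :
  measurable_fun setT (vol_elt k c F \o @rv R n).
Proof.
have mJ j l : measurable_fun setT (fun t => 'J (fe k c F) (@rv R n t) j l).
  rewrite (_ : (fun t => _) = fun t => \sum_(b | is_loc_node b)
      partial (W := R^o) j (phi b) (rv t) * F (glob_node c b) ord0 l); last first.
    by apply/funext => t; exact: J_entry.
  apply: (@measurable_loc_sum (fun b t => partial (W := R^o) j (phi b) (rv t) *
    F (glob_node c b) ord0 l)) => b.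
  apply: measurable_funM; last exact: measurable_cst.
  by have [_ _ [_ /(_ j)]] := phiK b.
apply: (@measurableT_comp _ _ _ _ _ _ (@Num.sqrt R) _
  (fun t => \det ('J (fe k c F) (@rv R n t) *m ('J (fe k c F) (@rv R n t))^T))).
  by apply: continuous_measurable_fun; exact: sqrt_continuous.
pose G t i j := \sum_l 'J (fe k c F) (@rv R n t) i l * 'J (fe k c F) (rv t) j l.
have mG i j : measurable_fun setT (fun t => G t i j).
  apply: (@measurable_sum _ _ R setT _ _
    (fun l t => 'J (fe k c F) (@rv R n t) i l * 'J (fe k c F) (rv t) j l)) => l.
  by apply: measurable_funM; exact: mJ.
rewrite (_ : (fun t => _) =
    fun t => \sum_(s : 'S_n) (-1) ^+ s * \prod_i G t i (s i)); last first.
  apply/funext => t; rewrite /determinant /G.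
  move: ('J (fe k c F) (rv t)) => A.
  apply: eq_bigr => s _; congr (_ * _); apply: eq_bigr => i _.
  by rewrite mxE; apply: eq_bigr => l _; rewrite [X in _ * X]mxE.
apply: (@measurable_sum _ _ R setT _ _
  (fun (s : 'S_n) t => (-1) ^+ s * \prod_i G t i (s i))) => s.
apply: measurable_funM; first exact: measurable_cst.
exact: (@measurable_prod _ _ R setT _ _ (fun i t => G t i (s i)) (fun i _ => mG i (s i))).
Qed.

Definition nodal_max (f : node nV -> R^o) : R :=
  \big[Num.max/0]_(b : loc_node k n | is_loc_node b) `|f (glob_node c b)|.

Lemma nodal_max_ge0 f : 0 <= nodal_max f. Proof. exact: bigmax_ge_id. Qed.

Lemma nodal_max_ge f (b : loc_node k n) : is_loc_node b -> `|f (glob_node c b)| <= nodal_max f.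
Proof. by move=> bk; exact: (le_bigmax_cond _ (fun b => `|f (glob_node c b)|)). Qed.

Lemma fe_le_nodal_max f x : ref_simplex x -> `|fe k c f x| <= nloc * (K * nodal_max f).
Proof.
move=> Tx; rewrite fe_scalar; apply: loc_sum_le => [|b bk].
  by rewrite mulr_ge0 ?nodal_max_ge0.
rewrite normrM; apply: ler_pM => //; last exact: nodal_max_ge.
by have [_ _ _ /(_ x Tx) []] := phiK b.
Qed.

(** Shape functions being K-Lipschitz, a finite element function varies by at most
    half of its largest nodal value within this distance. *)
Definition near_radius : R := (2 * (nloc * K) + 1)^-1.

Lemma near_radius_itv : 0 < near_radius <= 1.
Proof.
have H : 0 <= nloc * K by rewrite mulr_ge0 ?nloc_ge0.
have p : 0 < 2 * (nloc * K) + 1 by lra.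
by rewrite /near_radius invr_gt0 p /= invf_le1//; lra.
Qed.

(** The nodal value of largest modulus is a value of the function in the simplex.
    This is what replaces the equivalence of norms on polynomials, with a constant
    that does not depend on the exponent of the norm. *)
Lemma fe_near_max f : exists2 x0 : 'rV[R]_n, ref_simplex x0 &
  forall x, ref_simplex x -> (forall i, `|x ord0 i - x0 ord0 i| <= near_radius) ->
    nodal_max f / 2 <= `|fe k c f x|.
Proof.
have [f0|[b bk fb]] : nodal_max f = 0 \/ exists2 b : loc_node k n,
    is_loc_node b & nodal_max f = `|f (glob_node c b)|.
  rewrite /nodal_max; elim/big_ind : _ => [|u v Hu Hv|b bk]; first by left.
    by case: (leP u v).
  by right; exists b.
  exists 0; last by move=> x _ _; rewrite f0 mul0r.
  by split=> [i|]; rewrite ?mxE// big1// => i _; rewrite mxE.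
exists (loc_pt R b); first exact: loc_pt_simplex.
move=> x Tx xb; have Tb := loc_pt_simplex R k0 bk.
have /andP[rho0 rho1] := near_radius_itv.
have H : `|fe k c f x - f (glob_node c b)| <= nloc * (K * near_radius * nodal_max f).
  rewrite -(fe_loc_pt f bk) !fe_scalar -sumrB; apply: loc_sum_le.
    by rewrite !mulr_ge0 ?nodal_max_ge0// ltW.
  move=> b' b'k; rewrite -mulrBl normrM; apply: ler_pM => //; last exact: nodal_max_ge.
  by have [_ _ _ _ lip] := phiK b'; apply: lip => //; exact: ltW.
have H2 : nloc * (K * near_radius * nodal_max f) <= nodal_max f / 2.
  rewrite (_ : _ * _ = (nloc * K * near_radius) * nodal_max f); last by ring.
  rewrite mulrC; apply: ler_wpM2l; first exact: nodal_max_ge0.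
  have nK : 0 <= nloc * K by rewrite mulr_ge0 ?nloc_ge0.
  rewrite /near_radius ler_pdivrMr; lra.
have := lerB_dist (f (glob_node c b)) (fe k c f x).
rewrite distrC -fb => H3; have := le_trans H3 (le_trans H H2); lra.
Qed.

End cell_estimate.

(** * Integrals and norms over the facets *)

Section norm_bounds.
Variables (R : realType) (n k nV : nat).
Local Notation Rd := 'rV[R]_n.+1.
Variable K : R.
Hypothesis phiK : forall b : loc_node k n, tame K (Defs.lagrange (R := R) b).

Lemma min_le_powR (x t : R) : 0 <= x -> 0 < t <= 1 -> Num.min 1 x <= x `^ t.
Proof.
move=> x0 /andP[t0 t1]; case: (leP 1 x) => x1.
  have E : 1 `^ t = 1 :> R by rewrite powR1.
  by have := @ge0_ler_powR R t (ltW t0) 1 x; rewrite E; apply; rewrite ?nnegrE.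
have [->|xn0] := eqVneq x 0; first exact: powR_ge0.
have xp : 0 < x by rewrite lt_def xn0.
by rewrite -[leLHS](powRr1 x0) ger_powR// xp ltW.
Qed.

Lemma fe_Lnorm_ge0 (I : finType) (c : I -> 'I_n.+1 -> 'I_nV) (F : node nV -> Rd)
  q g : (0 <= fe_Lnorm k c F q g)%E.
Proof. by case: q => [q||] //=; rewrite ?poweR_ge0// le_max lexx. Qed.

(** On each cell, g is at least a i on a cube of fixed volume in reference
    coordinates.  The p-th root of a number x is at least the minimum of 1 and x,
    hence a constant that does not depend on p. *)
Lemma fe_Lnorm_ge (I : finType) (c : I -> 'I_n.+1 -> 'I_nV) (F : node nV -> Rd)
    (p : \bar R) (g : I -> 'rV[R]_n -> R) (a : I -> R) (rho v0 h : R) :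
  (1 <= p)%E -> 0 <= h -> 0 <= v0 -> 0 < rho <= 1 ->
  (forall i, measurable_fun setT (g i \o @rv R n)) -> (forall i, 0 <= a i) ->
  (forall i x, ref_simplex x -> h ^+ n * v0 <= vol_elt k (c i) F x) ->
  (forall i, exists2 x0 : 'rV[R]_n, ref_simplex x0 & forall x, ref_simplex x ->
     (forall j, `|x ord0 j - x0 ord0 j| <= rho) -> a i <= `|g i x|) ->
  ((Num.min 1 (v0 * (rho / n.+1%:R) ^+ n) * dnorm (h ^+ n) p a)%:E <=
    fe_Lnorm k c F p g)%E.
Proof.
move=> p1 h0 v00 /andP[rho0 rho1] mg a0 vol_ge near.
have hn0 : 0 <= h ^+ n by exact: exprn_ge0.
set be := (rho / n.+1%:R) ^+ n.
have be0 : 0 <= be by rewrite exprn_ge0// divr_ge0// ltW.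
have vb0 : 0 <= v0 * be by exact: mulr_ge0.
case: p p1 => [p||//] p1; last first.
  apply: (@le_trans _ _ (dnorm (h ^+ n) +oo%E a)%:E).
    by rewrite lee_fin ler_piMl ?dnorm_ge0// ge_min lexx.
  rewrite /fe_Lnorm /dnorm; elim/big_ind : _ => [|u v Hu Hv|i _].
  - by rewrite le_max lexx.
  - by case: (leP u v).
  - have [x0 Tx0 Hx0] := near i; rewrite le_max; apply/orP; right.
    apply: (@le_trans _ _ `|g i x0|%:E).
      rewrite lee_fin Hx0// => j; rewrite subrr normr0; exact: ltW.
    by apply: ereal_sup_ubound; exists (i, x0).
rewrite lee_fin in p1; have p0 : 0 < p by exact: lt_le_trans p1.
rewrite /fe_Lnorm.
set T := (X in (X `^ _)%E).
have TE : ((v0 * be * \sum_i h ^+ n * a i `^ p)%:E <= T)%E.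
  rewrite /T mulr_sumr -sumEFin; apply: lee_sum => i _.
  have [x0 Tx0 Hx0] := near i.
  rewrite (_ : v0 * be * _ = (a i `^ p * (h ^+ n * v0)) * be); last by ring.
  apply: (@simplex_integral_ge R n
    (fun x => `|g i x| `^ p * vol_elt k (c i) F x) x0 rho).
  - apply: measurable_funM; last exact: (measurable_vol_elt phiK).
    apply: (@measurableT_comp _ _ _ _ _ _ (@powR R ^~ p)) => //.
    exact: (measurableT_comp (@normr_measurable R setT) (mg i)).
  - by move=> x Tx; rewrite mulr_ge0 ?powR_ge0 ?sqrtr_ge0.
  - exact: Tx0.
  - by rewrite (ltW rho0).
  - by rewrite !mulr_ge0 ?powR_ge0.
  - move=> x Tx xx0; apply: ler_pM; rewrite ?powR_ge0 ?mulr_ge0//.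
      by apply: ge0_ler_powR; rewrite ?nnegrE ?(ltW p0)//; exact: Hx0.
    exact: vol_ge.
have S0 : 0 <= \sum_i h ^+ n * a i `^ p.
  by apply: sumr_ge0 => i _; rewrite mulr_ge0 ?powR_ge0.
apply: (@le_trans _ _ ((v0 * be * \sum_i h ^+ n * a i `^ p)%:E `^ p^-1)%E); last first.
  apply: gt0_ler_poweR => //; first by rewrite invr_ge0 ltW.
    by rewrite in_itv/= leey andbT lee_fin mulr_ge0.
  rewrite in_itv/= leey andbT; apply: le_trans TE.
  by rewrite lee_fin mulr_ge0.
rewrite poweR_EFin lee_fin powRM// /dnorm; apply: ler_wpM2r; first exact: powR_ge0.
by apply: min_le_powR => //; rewrite invr_gt0 p0 invf_le1.
Qed.

End norm_bounds.

Section cell_integrals.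
Variables (R : realType) (n k nV : nat).
Local Notation Rd := 'rV[R]_n.+1.
Hypothesis k0 : (0 < k)%N.
Variable K : R.
Hypothesis phiK : forall b : loc_node k n, tame K (Defs.lagrange (R := R) b).
Variable c : 'I_n.+1 -> 'I_nV.

Lemma cell_int_diff (P Q : node nV -> Rd) (f g : node nV -> R^o) (B d : R) :
  0 <= d ->
  (forall x j l, ref_simplex x -> `|'J (fe k c P) x j l| <= B) ->
  (forall x j l, ref_simplex x -> `|'J (fe k c Q) x j l| <= B) ->
  (forall x, ref_simplex x -> `|vol_elt k c P x - vol_elt k c Q x| <= d) ->
  `|cell_int k c P (fun x => fe k c f x * fe k c g x) -
    cell_int k c Q (fun x => fe k c f x * fe k c g x)| <=
  (nloc R n k * K) ^+ 2 * (d * nodal_max k c f * nodal_max k c g).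
Proof.
move=> d0 JP JQ PQd.
pose w x := fe k c f x * fe k c g x.
have K0 : 0 <= K by case: (phiK [ffun=> ord0]).
pose Bw := (nloc R n k * (K * nodal_max k c f)) * (nloc R n k * (K * nodal_max k c g)).
have Bw0 : 0 <= Bw by rewrite !mulr_ge0 ?nloc_ge0 ?nodal_max_ge0.
have wB x : ref_simplex x -> `|w x| <= Bw.
  by move=> Tx; rewrite normrM; apply: ler_pM => //; exact: fe_le_nodal_max.
have mw : measurable_fun setT (w \o @rv R n).
  exact: (measurable_funM (measurable_fe phiK c f) (measurable_fe phiK c g)).
have int_w (F : node nV -> Rd) :
    (forall x j l, ref_simplex x -> `|'J (fe k c F) x j l| <= B) ->
    (leb R n).-integrable (@rv R n @^-1` @ref_simplex R n)
      (EFin \o (fun t => w (rv t) * vol_elt k c F (rv t))).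
  move=> JF; apply: (@simplex_integrable R n (fun x => w x * vol_elt k c F x)
    (Bw * Num.sqrt (n`!%:R * (n.+1%:R * B ^+ 2) ^+ n))).
    exact: (measurable_funM mw (measurable_vol_elt phiK c F)).
  move=> x Tx; rewrite normrM; apply: ler_pM => //; first exact: wB.
  by apply: vol_elt_bounded => j l; exact: JF.
rewrite /cell_int -RintegralB; [|exact: measurable_simplex|exact: int_w|exact: int_w].
rewrite (_ : (_ ^+ 2) * _ = Bw * d); last by rewrite /Bw; ring.
under eq_Rintegral => t _ do rewrite -mulrBr.
apply: (@simplex_Rintegral_le R n
  (fun x => w x * (vol_elt k c P x - vol_elt k c Q x))); first exact: mulr_ge0.
  exact: (measurable_funM mw (measurable_funB (measurable_vol_elt phiK c P)
    (measurable_vol_elt phiK c Q))).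
by move=> x Tx; rewrite normrM; apply: ler_pM => //; [exact: wB|exact: PQd].
Qed.

Definition vec_nodal_max (e : node nV -> Rd) : R :=
  \big[Num.max/0]_l nodal_max k c (fun z => e z ord0 l).

Lemma vec_nodal_max_ge0 (e : node nV -> Rd) : 0 <= vec_nodal_max e. Proof. exact: bigmax_ge_id. Qed.

Lemma vec_nodal_max_ge (e : node nV -> Rd) (b : loc_node k n) l :
  is_loc_node b -> `|e (glob_node c b) ord0 l| <= vec_nodal_max e.
Proof.
move=> bk; apply: le_trans (le_bigmax _ _ l).
exact: (@nodal_max_ge R n k nV c (fun z => e z ord0 l)).
Qed.

Lemma fe_enorm_near_max (e : node nV -> Rd) : exists2 x0 : 'rV[R]_n, ref_simplex x0 &
  forall x, ref_simplex x ->
    (forall i, `|x ord0 i - x0 ord0 i| <= near_radius n k K) ->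
    vec_nodal_max e / 2 <= `|enorm (fe k c e x)|.
Proof.
have [l el] : exists l, vec_nodal_max e = nodal_max k c (fun z => e z ord0 l).
  have [e0|] : vec_nodal_max e = 0 \/
      exists l, vec_nodal_max e = nodal_max k c (fun z => e z ord0 l).
    rewrite /vec_nodal_max; elim/big_ind : _ => [|u v Hu Hv|l _]; first by left.
      by case: (leP u v).
    by right; exists l.
  - exists ord0; apply/le_anti; rewrite {1}e0 nodal_max_ge0 /=.
    exact: (le_bigmax _ (fun l => nodal_max k c (fun z => e z ord0 l))).
  - by [].
have [x0 Tx0 H] := fe_near_max k0 phiK c (fun z => e z ord0 l).
exists x0 => // x Tx xx0; rewrite el; apply: le_trans (H x Tx xx0) _.
rewrite -fe_coord [leRHS]ger0_norm ?enorm_ge0//; exact: coord_le_enorm.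
Qed.

Lemma measurable_fe_enorm (e : node nV -> Rd) :
  measurable_fun setT ((fun x => enorm (fe k c e x)) \o @rv R n).
Proof.
apply: (@measurableT_comp _ _ _ _ _ _ (@Num.sqrt R) _
  (fun t => \sum_l fe k c e (@rv R n t) ord0 l ^+ 2)).
  by apply: continuous_measurable_fun; exact: sqrt_continuous.
apply: (@measurable_sum _ _ R setT _ _ (fun l t => fe k c e (@rv R n t) ord0 l ^+ 2)) => l.
apply: measurable_funX.
rewrite (_ : (fun t => _) = fe k c (fun z => e z ord0 l : R^o) \o @rv R n).
  exact: measurable_fe.
by apply/funext => t; exact: fe_coord.
Qed.

End cell_integrals.

Lemma bound_third (R : realType) (x1 x2 x3 x4 x5 y : \bar R) :
  (0 <= x1)%E -> (0 <= x2)%E -> (0 <= x3)%E -> (0 <= x4)%E -> (0 <= x5)%E ->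
  (x1 + x2 + x3 + x4 + x5 <= y)%E -> (x3 <= y)%E.
Proof.
move=> x10 x20 x30 x40 x50; apply: le_trans.
apply: le_trans (leeDl _ x50); apply: le_trans (leeDl _ x40).
by rewrite leeDr// adde_ge0.
Qed.

Section facet_bounds.
Variables (R : realType) (n k nV nE nF : nat) (M : mesh R n nV nE nF).
Local Notation Rd := 'rV[R]_n.+1.
Hypothesis k3 : (3 <= k)%N.
Variable K : R.
Hypothesis phiK : forall b : loc_node k n, tame K (Defs.lagrange (R := R) b).
Variable sigma : R.
Hypotheses (sigma0 : 0 < sigma) (conf : conforming M) (qu : quasi_uniform M sigma)
  (ifcs : interface_facets M).

Let phi_diff (b : loc_node k n) (x : 'rV[R]_n) :
  differentiable (Defs.lagrange b : _ -> R^o) x.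
Proof. by case: (phiK b). Qed.

Lemma facet_J_le m s (F : node nV -> 'rV[R]_m) (B : R) i x j l : (1 <= s)%N ->
  (fe_Wnorm k M (ifc M) s +oo F <= B%:E)%E -> ref_simplex x ->
  `|'J (fe k (ifc M i) F) x j l| <= n.+1%:R * (mesh_size M * B).
Proof.
move=> s1 FB Tx; apply: (J_le (M := M)) => //.
- exact: (facet_gram_unit sigma0 conf qu ifcs).
- by move=> j' l'; exact: facet_edges_le.
- exact: fe_Wnorm_tensor FB Tx.
Qed.

Variables (Q : node nV -> Rd) (nu : R).
Hypothesis omegaQ : omega k M (ifc M) Q = nu%:E.

Lemma omega_bounds (i : 'I_nF) :
  [/\ 0 <= nu, (fe_Wnorm k M (ifc M) k.-2 +oo Q <= nu%:E)%E
    & (inv_W1norm k M (ifc M) Q <= nu%:E)%E].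
Proof.
have W0 := @fe_Wnorm_ge0 R n nV nE nF k n M _ (ifc M) n.+1.
have I0 := inv_W1norm_ge0 k M (ifc M) i Q.
rewrite -omegaQ /omega; split.
- by rewrite -lee_fin -omegaQ !adde_ge0.
- by rewrite addeAC leeDr// adde_ge0.
- by rewrite leeDr// adde_ge0.
Qed.

Lemma facet_JQ_le i x j l : ref_simplex x ->
  `|'J (fe k (ifc M i) Q) x j l| <= n.+1%:R * (nu + 1) * mesh_size M.
Proof.
move=> Tx; have [nu0 W _] := omega_bounds i.
have s1 : (1 <= k.-2)%N by case: k k3 => [|[|[|]]].
apply: le_trans (facet_J_le i j l s1 W Tx) _.
rewrite mulrCA mulrC; apply: ler_wpM2r; first exact: mesh_size_ge0.
by apply: ler_wpM2l => //; rewrite lerDl.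
Qed.

Lemma facet_JQ_ge i x (v : 'rV[R]_n) j : ref_simplex x ->
  (sigma * (nu + 1))^-1 * mesh_size M * `|v ord0 j| <=
    enorm (v *m 'J (fe k (ifc M i) Q) x).
Proof.
move=> Tx; have [nu0 _ W] := omega_bounds i.
have s0 : 0 < sigma * (nu + 1) by rewrite mulr_gt0// ltr_wpDl.
rewrite -mulrA ler_pdivrMl// mulrC -mulrA.
have := facet_coords_le sigma0 conf qu ifcs i v j; rewrite mulrC => /le_trans; apply.
by apply: ler_wpM2l; [exact: ltW|exact: inv_grad_bound].
Qed.

End facet_bounds.

(** * Summation over the interface *)

Lemma lee_prod3 (R : realType) (c y1 y2 y3 : R) (Y1 Y2 Y3 : \bar R) :
  0 <= c -> 0 <= y1 -> 0 <= y2 -> 0 <= y3 ->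
  (y1%:E <= Y1)%E -> (y2%:E <= Y2)%E -> (y3%:E <= Y3)%E ->
  ((c * y1 * y2 * y3)%:E <= c%:E * Y1 * Y2 * Y3)%E.
Proof.
move=> c0 y10 y20 y30 H1 H2 H3; rewrite !EFinM.
apply: lee_pmul => //; rewrite ?lee_fin// -?EFinM ?lee_fin ?mulr_ge0//.
rewrite !EFinM; apply: lee_pmul => //; rewrite -?EFinM ?lee_fin ?mulr_ge0//.
by rewrite EFinM; apply: lee_pmul => //; rewrite lee_fin.
Qed.

Section facet_estimate.
Variables (R : realType) (n k nV nE nF : nat) (M : mesh R n nV nE nF).
Local Notation Rd := 'rV[R]_n.+1.
Hypothesis k3 : (3 <= k)%N.
Variable K : R.
Hypothesis phiK : forall b : loc_node k n, tame K (Defs.lagrange (R := R) b).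
Variables (S : flow R n) (t Cs : R).
Hypotheses (tT : 0 <= t <= Tend S) (Cs0 : 0 < Cs).
Hypothesis chordS : forall (y z : Rd) (s d eps : R),
  Gam S t y -> Gam S t z ->
  (forall l, `|z ord0 l - y ord0 l| <= d) ->
  (forall l, `|(s *: nrm S t y) ord0 l| <= eps) ->
  `|\sum_l (z ord0 l - y ord0 l) * (s *: nrm S t y) ord0 l| <= Cs * d ^+ 2 * eps.
Variable sigma : R.
Hypotheses (sigma0 : 0 < sigma) (proj : smooth_projection S 2)
  (conf : conforming M) (qu : quasi_uniform M sigma) (ifcs : interface_facets M).
Variable X : node nV -> Rd.
Hypothesis tubeX : forall z, ifc_node k M z -> tube S (width S) t (X z).
Local Notation Q := (Xhat_ifc S t X).
Local Notation e := (ehat S t X).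
Variable nu : R.
Hypotheses (omegaQ : omega k M (ifc M) Q = nu%:E) (h1 : mesh_size M <= 1)
  (eW : (fe_Wnorm k M (ifc M) 1 +oo e <= (mesh_size M)%:E)%E).

(** A point of the tube is on the normal through its distance projection. *)
Lemma node_error z : ifc_node k M z ->
  Gam S t (Q z) /\ exists s, e z = s *: nrm S t (Q z).
Proof.
move=> zi; have [_ /(_ t (X z) tT (tubeX zi)) [Gz _ [s Es]] _] := proj.
by split => //; exists s; rewrite /ehat {1}Es /Xhat_ifc addrAC subrr add0r.
Qed.

Let a := n.+1%:R * (nu + 1).
Let b := (sigma * (nu + 1))^-1.

Let k0 : (0 < k)%N. Proof. exact: leq_trans k3. Qed.

Let nu0 (i : 'I_nF) : 0 <= nu. Proof. by case: (omega_bounds omegaQ i). Qed.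

Lemma facet_Je_le i x j l : ref_simplex x ->
  `|'J (fe k (ifc M i) e) x j l| <= a * mesh_size M ^+ 2.
Proof.
move=> Tx; apply: le_trans (facet_J_le phiK sigma0 conf qu ifcs i j l _ eW Tx) _ => //.
rewrite -expr2; apply: ler_wpM2r; first exact: sqr_ge0.
by rewrite /a ler_peMr// lerDr (nu0 i).
Qed.

Let XE : X = (fun z => Q z + e z).
Proof. by apply/funext => z; rewrite /ehat subrKC. Qed.

Let a1 (i : 'I_nF) : 1 <= a.
Proof.
rewrite /a -[leLHS]mulr1; apply: ler_pM => //; first by rewrite ler1n.
by rewrite lerDr (nu0 i).
Qed.

Let b0 (i : 'I_nF) : 0 < b.
Proof. by rewrite invr_gt0 mulr_gt0// ltr_wpDl// (nu0 i). Qed.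

Lemma facet_vol_diff i x : ref_simplex x ->
  `|vol_elt k (ifc M i) X x - vol_elt k (ifc M i) Q x| <=
    mesh_size M ^+ n * (vol_const n k K a b Cs * vec_nodal_max k (ifc M i) e).
Proof.
move=> Tx; rewrite [X in vol_elt _ _ X](XE).
have ep0 : 0 <= vec_nodal_max k (ifc M i) e by exact: vec_nodal_max_ge0.
apply: (vol_elt_diff k0 phiK (facet_mesh_size_gt0 conf ifcs i) h1 (a1 i) (b0 i)
  (ltW Cs0) ep0) => //.
- by move=> y j l Ty; exact: (facet_JQ_le k3 phiK sigma0 conf qu ifcs omegaQ).
- by move=> y j l Ty; exact: facet_Je_le.
- by move=> y v j Ty; exact: (facet_JQ_ge sigma0 conf qu ifcs omegaQ).
- by move=> p l pk; exact: vec_nodal_max_ge.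
- move=> p q d pk qk pq.
  have [|Gp _] := @node_error (glob_node (ifc M i) p); first by exists i, p.
  have [|Gq [s Es]] := @node_error (glob_node (ifc M i) q); first by exists i, q.
  rewrite Es; apply: chordS => // l; rewrite -Es; exact: vec_nodal_max_ge.
Qed.

Definition vol_lower_const : R := Num.sqrt ((b ^+ 2 / n.+1%:R) ^+ n / n`!%:R).

Lemma facet_vol_ge i x : ref_simplex x ->
  mesh_size M ^+ n * vol_lower_const <= vol_elt k (ifc M i) Q x.
Proof.
move=> Tx; apply: (vol_elt_ge (facet_mesh_size_gt0 conf ifcs i) (b0 i)) => //.
by move=> y v j Ty; exact: (facet_JQ_ge sigma0 conf qu ifcs omegaQ).
Qed.

Lemma facet_int_diff i (f g : node nV -> R^o) :
  `|cell_int k (ifc M i) X (fun x => fe k (ifc M i) f x * fe k (ifc M i) g x) -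
    cell_int k (ifc M i) Q (fun x => fe k (ifc M i) f x * fe k (ifc M i) g x)| <=
  (nloc R n k * K) ^+ 2 * (mesh_size M ^+ n * (vol_const n k K a b Cs *
     vec_nodal_max k (ifc M i) e) * nodal_max k (ifc M i) f * nodal_max k (ifc M i) g).
Proof.
have h0 : 0 <= mesh_size M by exact: mesh_size_ge0.
have a00 : 0 <= a by exact: le_trans (a1 i).
have K0 : 0 <= K by case: (phiK [ffun=> ord0]).
have Tx0 : ref_simplex (0 : 'rV[R]_n).
  by split=> [l|]; rewrite ?mxE// big1// => l _; rewrite mxE.
apply: (@cell_int_diff R n k nV K phiK (ifc M i) X Q f g (a * mesh_size M + a * mesh_size M ^+ 2)).
- exact: le_trans (facet_vol_diff i Tx0).
- move=> x j l Tx; rewrite [X in fe _ _ X](XE).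
  have -> : 'J (fe k (ifc M i) (fun z => Q z + e z)) x j l =
     'J (fe k (ifc M i) Q) x j l + 'J (fe k (ifc M i) e) x j l.
    by rewrite (J_add phiK (ifc M i)) mxE.
  apply: le_trans (ler_normD _ _) _; apply: lerD; last exact: facet_Je_le.
  exact: (facet_JQ_le k3 phiK sigma0 conf qu ifcs omegaQ).
- move=> x j l Tx; apply: (@le_trans _ _ (a * mesh_size M)).
    exact: (facet_JQ_le k3 phiK sigma0 conf qu ifcs omegaQ).
  by rewrite lerDl mulr_ge0// sqr_ge0.
- by move=> x Tx; exact: facet_vol_diff.
Qed.

Definition surf_norm_const : R :=
  Num.min 1 (vol_lower_const * (near_radius n k K / n.+1%:R) ^+ n).

Lemma surf_norm_ge (p : \bar R) (f : node nV -> R^o) : (1 <= p)%E ->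
  ((surf_norm_const * dnorm (mesh_size M ^+ n) p (fun i => nodal_max k (ifc M i) f / 2))%:E <=
   surf_norm k M Q p f)%E.
Proof.
move=> p1; have K0 : 0 <= K by case: (phiK [ffun=> ord0]).
apply: (fe_Lnorm_ge phiK p1 (mesh_size_ge0 M) (sqrtr_ge0 _) (near_radius_itv phiK)) => i.
- exact: (measurable_fe phiK).
- by rewrite divr_ge0 ?nodal_max_ge0.
- by move=> x Tx; exact: facet_vol_ge.
- exact: (fe_near_max k0 phiK).
Qed.

Lemma surf_vnorm_ge (p : \bar R) : (1 <= p)%E ->
  ((surf_norm_const * dnorm (mesh_size M ^+ n) p (fun i => vec_nodal_max k (ifc M i) e / 2))%:E <=
   surf_vnorm k M Q p e)%E.
Proof.
move=> p1.
apply: (fe_Lnorm_ge phiK p1 (mesh_size_ge0 M) (sqrtr_ge0 _) (near_radius_itv phiK)) => i.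
- exact: (measurable_fe_enorm phiK).
- by rewrite divr_ge0 ?vec_nodal_max_ge0.
- by move=> x Tx; exact: facet_vol_ge.
- exact: (fe_enorm_near_max k0 phiK).
Qed.

Definition surf_int_const : R :=
  8 * (nloc R n k * K) ^+ 2 * vol_const n k K a b Cs / surf_norm_const ^+ 3.

Hypothesis nu_pos : 0 <= nu.

Lemma surf_norm_const_gt0 : 0 < surf_norm_const.
Proof.
have bp : 0 < b by rewrite invr_gt0 mulr_gt0// ltr_wpDl.
have /andP[rho0 _] := near_radius_itv phiK.
rewrite lt_min ltr01/= mulr_gt0 ?exprn_gt0 ?divr_gt0//.
by rewrite sqrtr_gt0 divr_gt0 ?ltr0n ?fact_gt0// exprn_gt0// divr_gt0// exprn_gt0.
Qed.

Lemma vol_const_ge0 : 0 <= vol_const n k K a b Cs.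
Proof.
have K0 : 0 <= K by case: (phiK [ffun=> ord0]).
have a00 : 0 <= a by rewrite mulr_ge0// addr_ge0.
have c0 : 0 <= cross_const n k K a Cs.
  apply: addr_ge0.
    apply: mulr_ge0; first exact: sqr_ge0.
    by apply: mulr_ge0; [exact: ltW|exact: sqr_ge0].
  by apply: mulr_ge0; apply: mulr_ge0 => //; exact: nloc_ge0.
apply: divr_ge0; last exact: sqrtr_ge0.
apply: mulr_ge0 => //; apply: mulr_ge0; last exact: mulr_ge0.
apply: mulr_ge0 => //; apply: exprn_ge0; apply: mulr_ge0 => //.
exact: sqr_ge0.
Qed.

Lemma surf_int_const_ge0 : 0 <= surf_int_const.
Proof.
rewrite /surf_int_const divr_ge0 ?exprn_ge0 ?(ltW surf_norm_const_gt0)//.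
apply: mulr_ge0; last exact: vol_const_ge0.
by apply: mulr_ge0 => //; exact: sqr_ge0.
Qed.

(** The integrals over one facet differ by a product of three nodal maxima and
    h^n.  The discrete Hoelder inequality bounds the sum of these products by
    discrete norms, and these by the norms over the mesh. *)
Lemma surf_int_diff (f g : node nV -> R^o) (p q r : \bar R) :
  (1 <= p)%E -> (1 <= q)%E -> (1 <= r)%E -> (p^-1 + q^-1 + r^-1 = 1)%E ->
  (`|surf_int k M X f g - surf_int k M Q f g|%:E <=
     surf_int_const%:E * surf_vnorm k M Q p e * surf_norm k M Q q f
       * surf_norm k M Q r g)%E.
Proof.
move=> p1 q1 r1 pqr; have g0 := surf_norm_const_gt0; have V0 := vol_const_ge0.
have hn0 : 0 <= mesh_size M ^+ n by rewrite exprn_ge0// mesh_size_ge0.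
set ga := surf_norm_const in g0 *; set V := vol_const n k K a b Cs in V0 *.
set N := nloc R n k * K.
pose E i := vec_nodal_max k (ifc M i) e / 2.
pose A i := nodal_max k (ifc M i) f / 2.
pose B i := nodal_max k (ifc M i) g / 2.
have E0 i : 0 <= E i by rewrite divr_ge0 ?vec_nodal_max_ge0.
have A0 i : 0 <= A i by rewrite divr_ge0 ?nodal_max_ge0.
have B0 i : 0 <= B i by rewrite divr_ge0 ?nodal_max_ge0.
have N0 : 0 <= N ^+ 2 by exact: sqr_ge0.
pose W := mesh_size M ^+ n.
(* The factor 8 compensates for the halves in E, A and B. *)
have H : `|surf_int k M X f g - surf_int k M Q f g| <=
    8 * N ^+ 2 * V * (dnorm W p E * dnorm W q A * dnorm W r B).
  apply: (@le_trans _ _ (8 * N ^+ 2 * V * \sum_i W * (E i * A i * B i))).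
    rewrite /surf_int -sumrB mulr_sumr; apply: le_trans (ler_norm_sum _ _ _) _.
    apply: ler_sum => i _; apply: le_trans (facet_int_diff i f g) _.
    rewrite -/V -/N -/W le_eqVlt; apply/orP; left; apply/eqP.
    by rewrite /E /A /B; field.
  apply: ler_wpM2l; last exact: dnorm_hoelder.
  by apply: mulr_ge0 => //; exact: mulr_ge0.
have D0 (s : \bar R) (u : 'I_nF -> R) : (forall i, 0 <= u i) -> 0 <= ga * dnorm W s u.
  by move=> u0; rewrite mulr_ge0 ?dnorm_ge0// ltW.
have F0 := surf_int_const_ge0.
apply: (@le_trans _ _ (surf_int_const * (ga * dnorm W p E) * (ga * dnorm W q A) *
    (ga * dnorm W r B))%:E).
  rewrite lee_fin; apply: le_trans H _; rewrite le_eqVlt; apply/orP; left; apply/eqP.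
  by rewrite /surf_int_const -/ga -/V -/N; field; exact: lt0r_neq0.
by apply: lee_prod3; rewrite ?D0//; [exact: surf_vnorm_ge|exact: surf_norm_ge..].
Qed.

End facet_estimate.

(* The dimension of the ambient space is d = n.+1. *)
Theorem lemma5p1 (R : realType) (n k : nat)
    (hd : n.+1 = 2%N \/ n.+1 = 3%N) (hk : (3 <= k)%N) :
  exists N : nat,
  forall S : flow R n, smooth_flow S N ->
  forall E : ('rV[R]_n.+1 -> R) -> 'rV[R]_n.+1 -> R,
    trace_extension S k E ->
  forall eta : 'rV[R]_n.+1 -> R, cutoff S eta ->
  forall sigma : R, 0 < sigma ->
  exists C : R -> R -> R, exists h0 : R -> R -> R -> R -> R,
    (forall mu nu mus nus, 0 < h0 mu nu mus nus) /\
    forall (nV nE nF : nat) (M : mesh R n nV nE nF),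
      fitted_triangulation M S -> quasi_uniform M sigma ->
    forall (F0 : node nV -> 'rV[R]_n.+1) (Phi0 : 'rV[R]_n.+1 -> 'rV[R]_n.+1),
      lenoir_mesh k M S F0 -> lenoir_lift k M S F0 Phi0 ->
    forall sz : sz_choice n nV nE nF, sz_admissible k M sz ->
    forall (tau : R) (m : nat), 0 < tau -> m%:R * tau <= Tend S ->
    let t := m%:R * tau in
    forall X : node nV -> 'rV[R]_n.+1,
      (forall z, ifc_node k M z -> tube S (width S) t (X z)) ->
    forall Ehe : node nV -> 'rV[R]_n.+1,
      is_Eh k M S E eta sz F0 Phi0 (ehat S t X) Ehe ->
    let Xhat z := X z - Ehe z in
    forall mu nu mus nus : R,
      omega k M (elt M) Xhat = mu%:E ->
      omega k M (ifc M) (Xhat_ifc S t X) = nu%:E ->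
      omega_star k M (elt M) Xhat = mus%:E ->
      omega_star k M (ifc M) (Xhat_ifc S t X) = nus%:E ->
      mesh_size M <= h0 mu nu mus nus ->
      induction_hypothesis k M S t F0 Phi0 X Ehe ->
    forall (f g : node nV -> R^o) (p q r : \bar R),
      (1 <= p)%E -> (1 <= q)%E -> (1 <= r)%E ->
      (p^-1 + q^-1 + r^-1 = 1)%E ->
      (`|surf_int k M X f g - surf_int k M (Xhat_ifc S t X) f g|%:E <=
       (C mu nu)%:E * surf_vnorm k M (Xhat_ifc S t X) p (ehat S t X)
         * surf_norm k M (Xhat_ifc S t X) q f
         * surf_norm k M (Xhat_ifc S t X) r g)%E.
Proof.
(* Two derivatives of the defining function of the interface suffice. *)
exists 2%N => S HS E _ eta _ sigma sigma0.
have [Cs Cs0 chord] := chord_normal HS.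
have [K _ phiK] := tame_lagrange R n k.
(* Without facets nu may be negative, and the absolute value keeps the constant
   nonnegative.  The mesh size is at most 1 so that h^2 is at most h. *)
exists (fun _ nu => `|surf_int_const n k K Cs sigma nu|), (fun _ _ _ _ => 1).
split=> // nV nE nF M [_ conf ifcs _] qu F0 Phi0 _ _ sz _ tau m tau0 mT t X tubeX
  Ehe _ Xhat mu nu mus nus _ om _ _ h1 ih f g p q r p1 q1 r1 pqr.
have [[_ _ _ proj] _] := HS.
have tT : 0 <= t <= Tend S by rewrite mT andbT mulr_ge0// ltW.
have [[i _]|nF0] := pselect (exists i : 'I_nF, True); last first.
  have int0 F : surf_int k M F f g = 0 by apply: big1 => i _; case: nF0; exists i.
  rewrite !int0 subrr normr0.
  by do 3?apply: mule_ge0; rewrite ?lee_fin//; exact: fe_Lnorm_ge0.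
have h0 := facet_mesh_size_gt0 conf ifcs i.
have [nu0 _ _] := omega_bounds om i.
rewrite (ger0_norm (surf_int_const_ge0 phiK Cs0 sigma0 nu0)).
apply: (surf_int_diff hk phiK tT Cs0) => //.
- by move=> y z s d eps; exact: chord.
have c2 : (0 <= (mesh_size M `^ (- (3 / 2)))%:E)%E by rewrite lee_fin powR_ge0.
have c1 : (0 <= ((mesh_size M)^-1)%:E)%E by rewrite lee_fin invr_ge0 ltW.
have := bound_third _ _ _ _ _ ih.
move=> /(_ (mule_ge0 c1 (fe_Wnorm_ge0 _ _ _ _ _ _)) (mule_ge0 c2 (fe_Wnorm_ge0 _ _ _ _ _ _))
 (mule_ge0 c1 (fe_Wnorm_ge0 _ _ _ _ _ _)) (mule_ge0 c2 (fe_Wnorm_ge0 _ _ _ _ _ _))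
 (mule_ge0 c2 (fe_Wnorm_ge0 _ _ _ _ _ _))) H.
have h0' : (0 <= (mesh_size M)%:E)%E by rewrite lee_fin ltW.
have := lee_wpmul2l h0' H.
by rewrite muleA -EFinM mulfV ?lt0r_neq0// mul1e mule1.
Qed.
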